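(* Let $\mathbb K$ be an algebraically closed field of characteristic zero and let $u,d$ be integers with $1<u<d/2$ and $\gcd(u,d)=1$. Let $\ell\ge d-2$ be an integer and consider an element of $\ker(\Phi_0)_{(1,\ell)}$ of the form $$A\,F_{q,1}+B\,F_{q+1,1},\qquad A=\sum_{|\alpha|=\ell-|\sigma_q-\tau_q|}a_\alpha X^\alpha,\qquad B=\sum_{|\beta|=\ell-|\sigma_{q+1}-\tau_{q+1}|}b_\beta X^\beta,$$ with $a_\alpha,b_\beta\in\mathbb K$ and $\alpha=(\alpha_0,\alpha_1,\alpha_2),\ \beta=(\beta_0,\beta_1,\beta_2)\in\mathbb N^3$. This element belongs to $\mathrm{Adj}_\ell(\mathcal C_{u,d})$ if and only if both of the following hold: (1) $a_\alpha=0$ for all $\alpha$ such that $u\alpha_1+d\alpha_2<(d-1)(u-1)-d|\tau_q|$ or $d\alpha_0+(d-u)\alpha_1<(d-1)(d-u-1)-(d-u)|\sigma_q-\tau_q|$; (2) $b_\beta=0$ for all $\beta$ such that $u\beta_1+d\beta_2<(d-1)(u-1)-u|\sigma_{q+1}-\tau_{q+1}|$ or $d\beta_0+(d-u)\beta_1<(d-1)(d-u-1)-d|\sigma_{q+1}|$.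
   Context: $\mathbb N$ contains $0$; $|\alpha|=\alpha_0+\alpha_1+\alpha_2$, $X^\alpha=X_0^{\alpha_0}X_1^{\alpha_1}X_2^{\alpha_2}$. $S=\mathbb K[T_0,T_1,X_0,X_1,X_2]$ is bigraded by $\mathrm{bideg}(T_i)=(1,0)$, $\mathrm{bideg}(X_j)=(0,1)$. $\Phi_0:S\to\mathbb K[T_0,T_1][Z]$ is the $\mathbb K$-algebra morphism $T_i\mapsto T_i$, $X_0\mapsto ZT_0^d$, $X_1\mapsto ZT_0^{d-u}T_1^u$, $X_2\mapsto ZT_1^d$. $\ker(\Phi_0)_{(1,\ell)}$ is the bidegree $(1,\ell)$ component of $\ker(\Phi_0)$. Euclidean data: $a_0=d-u$, $a_1=u$, and for $1\le i\le p-1$, $a_{i-1}=q_ia_i+a_{i+1}$ with $0\le a_{i+1}<a_i$, where $p$ is such that $a_p=0$; $q=\sum_{i=1}^{p-1}q_i$. Put $(b_1,c_1)=(d-u,u)$, $(\sigma_1,\tau_1,\alpha_1,\beta_1)=(0,1,1,0)$ (here $a_i$, $b_n$, $\alpha_n$, $\beta_n$ are integers unrelated to the coefficients and exponents in the claim), and for $1\le n\le q$: if $b_n-c_n\ge c_n$, then $(b_{n+1},c_{n+1})=(b_n-c_n,c_n)$ and $(\sigma_{n+1},\tau_{n+1},\alpha_{n+1},\beta_{n+1})=(\sigma_n-\alpha_n,\tau_n-\beta_n,\alpha_n,\beta_n)$; if $b_n-c_n<c_n$, then $(b_{n+1},c_{n+1})=(c_n,b_n-c_n)$ and $(\sigma_{n+1},\tau_{n+1},\alpha_{n+1},\beta_{n+1})=(\alpha_n,\beta_n,\sigma_n-\alpha_n,\tau_n-\beta_n)$.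 One has $b_q=b_{q+1}=1$. For $n\in\{q,q+1\}$: $F_{n,1}=T_0X_0^{-\sigma_n}X_2^{\tau_n}-T_1X_1^{\tau_n-\sigma_n}$ if $\sigma_n\le0$, and $F_{n,1}=T_0X_1^{\sigma_n-\tau_n}-T_1X_0^{\sigma_n}X_2^{-\tau_n}$ if $\sigma_n>0$. These lie in $\ker(\Phi_0)$ and have bidegree $(1,|\sigma_n-\tau_n|)$. $\mathcal C_{u,d}\subset\mathbb P^2_{\mathbb K}$ is the image of $(t_0:t_1)\mapsto(t_0^d:t_0^{d-u}t_1^u:t_1^d)$. A plane curve $\tilde{\mathcal C}$ is adjoint to $\mathcal C$ if, for every proper or infinitely near point $p$ of $\mathcal C$, it passes through $p$ with virtual multiplicity at least $m_p(\mathcal C)-1$, i.e.: let $\pi:X\to\mathbb P^2$ be the composition of the blow-ups of all proper and infinitely near points $p$ at which (the strict transform of) $\mathcal C$ has multiplicity $m_p(\mathcal C)\ge2$, and let $E_p^*$ be the total transform in $X$ of the exceptional divisor of the blow-up of $p$; then $\pi^*\tilde{\mathcal C}-\sum_p(m_p(\mathcal C)-1)E_p^*$ is effective. $\mathrm{Adj}_\ell(\mathcal C)$ is the $\mathbb K$-vector space of pencils of adjoints of degree $\ell$: forms $T_0C^0_\ell+T_1C^1_\ell\in S$ with $C^i_\ell\in\mathbb K[X_0,X_1,X_2]$ homogeneous of degree $\ell$, each being zero or defining scheme-theoretically a curve adjoint to $\mathcal C$. *)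

(* Defs.v *)
From HB Require Import structures.
From mathcomp Require Import all_boot all_order all_algebra.
From mathcomp Require Export mpoly.

Set Implicit Arguments.
Unset Strict Implicit.
Unset Printing Implicit Defensive.

Import Order.TTheory GRing.Theory Num.Theory.

Local Open Scope ring_scope.

Section BigradedRing.
Variable K : closedFieldType.

(* {mpoly K[2 + 3]} is K[T_0, T_1, X_0, X_1, X_2]. *)
Definition varT (i : 'I_2) : {mpoly K[2 + 3]} := 'X_(lshift 3 i).
Definition varX (j : 'I_3) : {mpoly K[2 + 3]} := 'X_(rshift 2 j).

Definition inS (C : {mpoly K[3]}) : {mpoly K[2 + 3]} :=
  C \mPo [tuple varX j | j < 3].

Definition bihomogeneous (k l : nat) (P : {mpoly K[2 + 3]}) : Prop :=
  forall m : 'X_{1..2 + 3}, m \in msupp P ->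
    (\sum_(i < 2) m (lshift 3 i) = k)%N /\ (\sum_(j < 3) m (rshift 2 j) = l)%N.

(* The parametrization (t_0 : t_1) |-> (t_0^d : t_0^(d-u) t_1^u : t_1^d). *)
Definition param (u d : nat) : 3.-tuple {mpoly K[2]} :=
  [tuple 'X_0 ^+ d; 'X_0 ^+ (d - u) * 'X_1 ^+ u; 'X_1 ^+ d].

(* In K[T_0, T_1][Z], Z is the polynomial variable 'X. *)
Definition Phi0 (u d : nat) (P : {mpoly K[2 + 3]}) : {poly {mpoly K[2]}} :=
  mmap (fun c : K => (c%:MP)%:P)
       (fun k : 'I_(2 + 3) =>
          match split k with
          | inl i => ('X_i : {mpoly K[2]})%:P
          | inr j => 'X * (tnth (param u d) j)%:P
          end) P.

Definition kerPhi0 (u d k l : nat) (P : {mpoly K[2 + 3]}) : Prop :=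
  bihomogeneous k l P /\ Phi0 u d P = 0.

End BigradedRing.

Section EuclideanData.
Local Open Scope nat_scope.

(* a i and qt i are the a_i and q_i of the Euclidean algorithm. *)
Definition euclidean_data (u d p : nat) (a qt : nat -> nat) : Prop :=
  [/\ a 0 = d - u, a 1 = u,
      forall i, 1 <= i -> i < p ->
        a i.-1 = qt i * a i + a i.+1 /\ a i.+1 < a i
    & a p = 0].

Definition euclidean_q (p : nat) (qt : nat -> nat) : nat :=
  \sum_(1 <= i < p) qt i.

End EuclideanData.

Record euclid_state := EuclidState {
  st_b : int; st_c : int;
  st_sigma : int; st_tau : int; st_alpha : int; st_beta : int }.

Definition state_step (s : euclid_state) : euclid_state :=
  let: EuclidState b c si ta al be := s in
  if c <= b - c then EuclidState (b - c) c (si - al) (ta - be) al be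
  else EuclidState c (b - c) al be (si - al) (ta - be).

(* The index starts at 1. *)
Definition state (u d n : nat) : euclid_state :=
  iter n.-1 state_step (EuclidState (d%:Z - u%:Z) u%:Z 0 1 1 0).

Definition sigma (u d n : nat) : int := st_sigma (state u d n).
Definition tau (u d n : nat) : int := st_tau (state u d n).

(* All exponents below are nonnegative for n = q, q + 1, since then
   u sigma_n + (d - u) tau_n = 1; absz only casts them to nat. *)
Definition F1 (K : closedFieldType) (u d n : nat) : {mpoly K[2 + 3]} :=
  let s := sigma u d n in
  let t := tau u d n in
  if s <= 0 then
    varT K 0 * varX K 0 ^+ absz (- s) * varX K 2 ^+ absz t - varT K 1 * varX K 1 ^+ absz (t - s)
  else
    varT K 0 * varX K 1 ^+ absz (s - t) - varT K 1 * varX K 0 ^+ absz s * varX K 2 ^+ absz (- t).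

Section Adjoints.
Variable K : closedFieldType.

(* C_{u,d}, as the set of its homogeneous coordinate vectors. *)
Definition curve (u d : nat) (v : 'I_3 -> K) : Prop :=
  exists (t : 'I_2 -> K) (c : K),
    [/\ (t 0 != 0) || (t 1 != 0), c != 0
      & forall j, v j = c * (tnth (param K u d) j).@[t] ].

(* F generates the homogeneous ideal of the plane curve C. *)
Definition defining_form (C : ('I_3 -> K) -> Prop) (F : {mpoly K[3]}) : Prop :=
  (exists n : nat, F \is n.-homog) /\
  forall (n : nat) (G : {mpoly K[3]}), G \is n.-homog ->
    ((forall v, C v -> G.@[v] = 0) <-> exists H, G = F * H).

(* Affine coordinates of the chart X_i <> 0 of P^2, centered at the point whose
   i-th homogeneous coordinate is 1 and whose other two are those of c. *)
Definition affine_chart (i : 'I_3) (c : 'I_2 -> K) : 3.-tuple {mpoly K[2]} :=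
  [tuple oapp (fun k : 'I_2 => (c k)%:MP + 'X_k) 1 (unlift i j) | j < 3].

(* Coordinates on the blow-up of the origin of the (x, y)-plane, centered at the
   point of the exceptional line in the direction (1 : c) for Some c, resp.
   (0 : 1) for None:  (x, y) |-> (x, x (y + c)),  resp.  (x, y) |-> (x y, y). *)
Definition blowup_chart (o : option K) : 2.-tuple {mpoly K[2]} :=
  match o with
  | Some c => [tuple 'X_0; 'X_0 * ('X_1 + c%:MP)]
  | None => [tuple 'X_0 * 'X_1; 'X_1]
  end.

Definition exceptional_eq (o : option K) : {mpoly K[2]} :=
  if o is Some _ then 'X_0 else 'X_1.

(* Multiplicity at the origin of the curve f = 0 (f nonzero): the monomial order
   of mpoly is graded, so mlast f has the least degree among those of f. *)
Definition mult0 (f : {mpoly K[2]}) : nat := mdeg (mlast f).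

(* near F phi f e: phi gives, in some coordinates (x, y) centered at a proper
   point p of P^2 or at a point p infinitely near to P^2, the composite
   map to P^2 of the blow-ups of the points p_1, ..., p_k preceding p, each of
   which has multiplicity at least 2 on the curve F = 0; in these coordinates,
   f = 0 is the strict transform of that curve, and e = 0 is the divisor
   \sum_i (m_(p_i) - 1) E_(p_i)^*. *)
Inductive near (F : {mpoly K[3]}) :
    3.-tuple {mpoly K[2]} -> {mpoly K[2]} -> {mpoly K[2]} -> Prop :=
| near_proper i c :
    near F (affine_chart i c) (F \mPo affine_chart i c) 1
| near_blowup phi f e (o : option K) f' :
    near F phi f e ->
    (2 <= mult0 f)%N ->
    f \mPo blowup_chart o = exceptional_eq o ^+ mult0 f * f' ->
    near F [tuple tnth phi j \mPo blowup_chart o | j < 3] f'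
      ((e \mPo blowup_chart o) * exceptional_eq o ^+ (mult0 f).-1).

(* The curve G = 0 is adjoint to C: the divisor pi^*(G) - \sum (m_p - 1) E_p^*
   is effective, i.e. in all the above coordinates the local equation of
   \sum (m_p - 1) E_p^* divides the pullback of G. Blowing up only the points
   preceding a given one is enough, because the coefficient of E_p in the
   divisor does not depend on the other points. *)
Definition adjoint (C : ('I_3 -> K) -> Prop) (G : {mpoly K[3]}) : Prop :=
  exists2 F, defining_form C F &
    forall phi f e, near F phi f e -> exists h, G \mPo phi = e * h.

Definition Adj (l : nat) (C : ('I_3 -> K) -> Prop) (P : {mpoly K[2 + 3]}) : Prop :=
  exists C0 C1 : {mpoly K[3]},
    [/\ C0 \is l.-homog, C1 \is l.-homog,
        C0 = 0 \/ adjoint C C0, C1 = 0 \/ adjoint C C1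
      & P = varT K 0 * inS C0 + varT K 1 * inS C1].

(* \sum_(|alpha| = l - k) a_alpha X^alpha *)
Definition form_of (l k : nat) (a : 'X_{1..3} -> K) : {mpoly K[3]} :=
  \sum_(m : 'X_{1..3 < l.+1} | (mdeg m + k == l)%N) a m *: 'X_[m].

End Adjoints.

(* Main.v *)
(* Let c(a, b) = (a - 1)(b - 1) be the conductor of the numerical semigroup
   <a, b>.  The curve X_1^d = X_0^(d-u) X_2^u is singular only at (1:0:0) and
   (0:0:1), where it is locally x^a = y^b.  Blowing up such a branch follows the
   subtractive Euclidean algorithm on (a, b), and along it "G is divisible by
   the local equation of the adjoint divisor" turns out to be equivalent to
   "every monomial x^i y^j of G has weight b i + a j >= c(a, b)".  Hence G is
   adjoint iff all its monomials have large weight at both points, and the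
   theorem becomes a statement on supports.

   At n = q the data satisfy F_q = T_0 X^mu - T_1 X^nu up to exchanging T_0 and
   T_1, where X^mu is free of X_1 and X^nu is a power of X_1, F_(q+1) being of the
   opposite kind.  The coefficients of T_0 and T_1 in the pencil are thus
   A X^mu + B X^nu' and A X^nu + B X^mu' (up to order and sign).  A monomial
   divisible by both X^mu and X^nu' has weight at least u d - 1, resp.
   (d - u) d - 1, so no cancellation occurs below the conductors and both A and B
   satisfy the condition separately.  Since mu and nu have weights differing by 1
   and c(a, b) - 1 is not in <a, b>, the conditions given by mu and by nu agree. *)
Require Import Defs.
From mathcomp Require Import all_boot all_order all_algebra.
From mathcomp Require Import mpoly.
From mathcomp Require Import zify ring.
Import Order.TTheory GRing.Theory Num.Theory.
Local Open Scope ring_scope.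
Set Implicit Arguments.
Unset Strict Implicit.
Unset Printing Implicit Defensive.

(** * Substitutions into polynomials and their supports *)

Lemma comp_mpolyA (R : comNzRingType) (n k r : nat) (p : {mpoly R[n]})
    (lq : n.-tuple {mpoly R[k]}) (lr : k.-tuple {mpoly R[r]}) :
  (p \mPo lq) \mPo lr = p \mPo [tuple tnth lq j \mPo lr | j < n].
Proof.
rewrite [p \mPo lq]comp_mpolyEX [RHS]comp_mpolyEX rmorph_sum; apply: eq_bigr => m _ /=.
rewrite linearZ !comp_mpolyX rmorph_prod; congr (_ *: _); apply: eq_bigr => i _ /=.
by rewrite rmorphXn tnth_mktuple.
Qed.

Lemma mcoeff_sum_mpolyX (R : nzRingType) (n k : nat) (p : {mpoly R[n]})
    (phi : 'X_{1..n} -> 'X_{1..k}) :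
  {in msupp p &, injective phi} ->
  {in msupp p, forall m,
    (\sum_(m' <- msupp p) p@_m' *: 'X_[R, phi m'])@_(phi m) = p@_m}.
Proof.
move=> inj m mp; rewrite raddf_sum /= (bigD1_seq m) //= ?msupp_uniq //.
rewrite mcoeffZ mcoeffX eqxx mulr1 big1_seq ?addr0 // => m' /andP[nm m'p].
by rewrite mcoeffZ mcoeffX (inj_in_eq inj) // (negPf nm) mulr0.
Qed.

Lemma msupp_sum_mpolyX (R : nzRingType) (n k : nat) (p : {mpoly R[n]})
    (phi : 'X_{1..n} -> 'X_{1..k}) (m' : 'X_{1..k}) :
  m' \in msupp (\sum_(m <- msupp p) p@_m *: 'X_[R, phi m]) ->
  exists2 m, m \in msupp p & m' = phi m.
Proof.
move/msupp_sum_le/flatten_mapP => [m]; rewrite filter_predT => mp.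
by move/msuppZ_le; rewrite msuppX inE => /eqP ->; exists m.
Qed.

(** A substitution sending monomials to monomials, injectively on the support of [p], produces no
    cancellation. The support is therefore transported exactly, and dividing by ['X_[mu]] only
    shifts it. *)
Lemma comp_mpoly_monomial (R : comNzRingType) (n k : nat) (p : {mpoly R[n]})
    (lq : n.-tuple {mpoly R[k]}) (phi : 'X_{1..n} -> 'X_{1..k})
    (phiE : forall m, 'X_[m] \mPo lq = 'X_[phi m])
    (inj : {in msupp p &, injective phi}) (mu : 'X_{1..k})
    (h : {mpoly R[k]}) (eph : p \mPo lq = 'X_[mu] * h) :
  {in msupp h, forall n', exists2 m, m \in msupp p & (mu + n')%MM = phi m} /\
  {in msupp p, forall m, exists2 n', n' \in msupp h & (mu + n')%MM = phi m}.
Proof.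
have {}eph : \sum_(m <- msupp p) p@_m *: 'X_[R, phi m] = h * 'X_[mu].
  rewrite mulrC -eph [p in RHS]mpolyE rmorph_sum /=; apply: eq_bigr => m _.
  by rewrite comp_mpolyZ phiE.
split=> [n' hn'|m mp].
  apply: (@msupp_sum_mpolyX R); rewrite eph mcoeff_msupp mcoeffMX.
  by rewrite -mcoeff_msupp.
have: phi m \in msupp (h * 'X_[mu]).
  by rewrite -eph mcoeff_msupp mcoeff_sum_mpolyX // -mcoeff_msupp.
by rewrite (perm_mem (msuppMX h mu)) => /mapP[n' hn' ->]; exists n'.
Qed.

Definition mnm2 (i j : nat) : 'X_{1..2} := [multinom [tuple i; j]].

Lemma mnm2E (i j : nat) : (mnm2 i j 0 = i) * (mnm2 i j 1 = j).
Proof. by rewrite !multinomE. Qed.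

Lemma mnm2P (m m' : 'X_{1..2}) : m 0 = m' 0 -> m 1 = m' 1 -> m = m'.
Proof.
move=> e0 e1; apply/mnmP => i.
case: i => [[|[|//]] lti].
  by rewrite (_ : Ordinal lti = 0) //; apply: val_inj.
by rewrite (_ : Ordinal lti = 1) //; apply: val_inj.
Qed.

Lemma mnm3P (m m' : 'X_{1..3}) : m 0 = m' 0 -> m 1 = m' 1 -> m 2 = m' 2 -> m = m'.
Proof.
move=> e0 e1 e2; apply/mnmP => i.
case: i => [[|[|[|//]]] lti].
- by rewrite (_ : Ordinal lti = 0) //; apply: val_inj.
- by rewrite (_ : Ordinal lti = 1) //; apply: val_inj.
by rewrite (_ : Ordinal lti = 2) //; apply: val_inj.
Qed.

Lemma mdeg2E (m : 'X_{1..2}) : mdeg m = (m 0%R + m 1%R)%N.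
Proof.
rewrite mdegE !big_ord_recl big_ord0 addn0.
by congr (m _ + m _)%N; apply: val_inj.
Qed.

Lemma mdeg3E (m : 'X_{1..3}) : mdeg m = (m 0%R + m 1%R + m 2%R)%N.
Proof.
rewrite mdegE !big_ord_recl big_ord0 addn0 addnA.
by congr (m _ + m _ + m _)%N; apply: val_inj.
Qed.

(** * Multiplicity at the origin *)

Section Multiplicity.
Context {K : closedFieldType}.
Implicit Types f h : {mpoly K[2]}.

Lemma mult0_le f m : m \in msupp f -> (mult0 f <= mdeg m)%N.
Proof. by move/mlast_lemc/lemc_mdeg. Qed.

Lemma meval_at0 {n} (f : {mpoly K[n]}) : f.@[fun => 0] = f@_0%MM.
Proof.
have E m : ('X_[m] : {mpoly K[n]}).@[fun => 0] = (m == 0%MM)%:R.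
  rewrite mevalX; have [->|/eqP nz] := eqVneq m 0%MM.
    by rewrite big1 // => i _; rewrite mnm0E.
  have [i nzi] : exists i, m i != 0%N.
    apply/existsP; rewrite -negb_forall; apply/negP => /forallP z.
    by apply: nz; apply/mnmP => i; rewrite mnm0E; apply/eqP.
  by rewrite (bigD1 i) //= expr0n (negPf nzi) mul0r.
rewrite [f in LHS]mpolyE rmorph_sum /= [f in RHS]mpolyE raddf_sum /=.
by apply: eq_bigr => m _; rewrite mevalZ E mcoeffZ mcoeffX.
Qed.

Lemma mult0_eq0 f : f.@[fun => 0] != 0 -> mult0 f = 0%N.
Proof.
rewrite meval_at0 -mcoeff_msupp => /mult0_le.
by rewrite mdeg0 leqn0 => /eqP.
Qed.

(** One half of the Jacobian criterion: the value and the partial derivatives at 0 are coefficients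
    of degree 0 and 1, which lie below the multiplicity. *)
Lemma mult0_ge2 f (i : 'I_2) : (2 <= mult0 f)%N ->
  f.@[fun => 0] = 0 /\ (f^`M(i)).@[fun => 0] = 0.
Proof.
move=> m2; rewrite !meval_at0 mcoeff_mderiv add0m mnm0E; split.
  by apply: memN_msupp_eq0; apply/negP => /mult0_le; rewrite mdeg0; lia.
rewrite memN_msupp_eq0 //; apply/negP => /mult0_le; rewrite mdeg1; lia.
Qed.

End Multiplicity.

Lemma mpolyX2E (R : nzRingType) (i j : nat) :
  'X_[mnm2 i j] = 'X_0 ^+ i * 'X_1 ^+ j :> {mpoly R[2]}.
Proof.
rewrite !mpolyXn -mpolyXD; congr 'X_[_].
by apply: mnm2P; rewrite mnmDE !mulmnE !mnm1E !mnm2E /= ?mul0n ?mul1n ?addn0.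
Qed.

(** * Blowing up the branch x^a = y^b *)

Section Branch.
Context {K : closedFieldType}.
Implicit Types (f h e : {mpoly K[2]}) (k : K) (a b : nat) (o : option K).

(** The scalar is needed because a defining form is fixed only up to a nonzero constant, and because
    the chart at (0:0:1) changes the sign. *)
Definition branch k a b : {mpoly K[2]} := k *: ('X_0 ^+ a - 'X_1 ^+ b).

(* The preimage in K[x, y] of the conductor of K[[t^b, t^a]]. *)
Definition conductor a b h : Prop :=
  {in msupp h, forall m : 'X_{1..2},
    ((a - 1) * (b - 1) <= b * m 0%R + a * m 1%R)%N}.

Lemma mult0_branch k a b : k != 0 -> (0 < a)%N -> (0 < b)%N ->
  mult0 (branch k a b) = minn a b.
Proof.
move=> nzk a0 b0.
have brE : branch k a b = k *: ('X_[mnm2 a 0] - 'X_[mnm2 0 b]).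
  by rewrite !mpolyX2E !expr0 mulr1 mul1r.
have ne : mnm2 0 b == mnm2 a 0 = false.
  by apply/eqP => /(congr1 (fun m : 'X_{1..2} => m 0%R)); rewrite !mnm2E; lia.
have sa : mnm2 a 0 \in msupp (branch k a b).
  by rewrite brE mcoeff_msupp mcoeffZ mcoeffB !mcoeffX eqxx ne subr0 mulr1.
have sb : mnm2 0 b \in msupp (branch k a b).
  rewrite brE mcoeff_msupp mcoeffZ mcoeffB !mcoeffX eqxx (eq_sym _ (mnm2 0 b)).
  by rewrite ne sub0r mulrN1 oppr_eq0.
have nz : branch k a b != 0.
  by apply/eqP => z; move: sa; rewrite z mcoeff_msupp mcoeff0 eqxx.
have := mlast_supp nz; rewrite {2}brE => /msuppZ_le/msuppB_le.
rewrite mem_cat !msuppX !inE => H.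
move: (mult0_le sa) (mult0_le sb) H; rewrite /mult0 !mdeg2E !mnm2E.
by move=> la lb /orP[] /eqP E; move: la lb; rewrite E !mnm2E; lia.
Qed.

Lemma comp_blowupX o (m : 'X_{1..2}) :
  'X_[m] \mPo blowup_chart o =
    match o with
    | Some c => 'X_0 ^+ (m 0%R + m 1%R) * ('X_1 + c%:MP) ^+ m 1%R
    | None => 'X_0 ^+ m 0%R * 'X_1 ^+ (m 0%R + m 1%R)
    end.
Proof.
rewrite comp_mpolyX !big_ord_recl big_ord0 mulr1.
have -> : lift ord0 ord0 = 1 :> 'I_2 by apply: val_inj.
have -> : ord0 = 0 :> 'I_2 by apply: val_inj.
case: o => [c|]; rewrite !(tnth_nth 0) /= exprMn exprD; first by rewrite mulrA.
by rewrite mulrA.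
Qed.

Lemma comp_blowup0X (m : 'X_{1..2}) :
  'X_[m] \mPo blowup_chart (Some (0 : K)) = 'X_[mnm2 (m 0%R + m 1%R) (m 1%R)].
Proof. by rewrite comp_blowupX mpolyX2E mpolyC0 addr0. Qed.

Lemma comp_blowupNX (m : 'X_{1..2}) :
  'X_[m] \mPo blowup_chart (None : option K) = 'X_[mnm2 (m 0%R) (m 0%R + m 1%R)].
Proof. by rewrite comp_blowupX mpolyX2E. Qed.

(** On exponents the chart acts by (i, j) |-> (i + j, j), which is injective; [n] stands on the left
    of the equations to avoid truncated subtraction. *)
Lemma comp_blowup0 h h' n :
  h \mPo blowup_chart (Some 0) = 'X_0 ^+ n * h' ->
  {in msupp h', forall m' : 'X_{1..2}, exists2 m : 'X_{1..2}, m \in msupp h &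
     (n + m' 0 = m 0 + m 1 /\ m' 1 = m 1)%R} /\
  {in msupp h, forall m : 'X_{1..2}, exists2 m' : 'X_{1..2}, m' \in msupp h' &
     (n + m' 0 = m 0 + m 1 /\ m' 1 = m 1)%R}.
Proof.
rewrite -['X_0 ^+ n]mulr1 -[1](expr0 'X_1) -mpolyX2E.
case/(comp_mpoly_monomial comp_blowup0X).
  move=> m1 m2 _ _ /= E; have := congr1 (fun m : 'X_{1..2} => (m 0%R, m 1%R)) E.
  by rewrite /= !mnm2E => -[e0 e1]; apply: mnm2P; lia.
move=> H1 H2; split=> m mh; [have [m2 m2h E] := H1 m mh|have [m2 m2h E] := H2 m mh];
  exists m2 => //; have := congr1 (fun m : 'X_{1..2} => (m 0%R, m 1%R)) E;
  by rewrite /= !mnmDE !mnm2E => -[].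
Qed.

Lemma comp_blowupN h h' n :
  h \mPo blowup_chart None = 'X_1 ^+ n * h' ->
  {in msupp h', forall m' : 'X_{1..2}, exists2 m : 'X_{1..2}, m \in msupp h &
     (m' 0 = m 0 /\ n + m' 1 = m 0 + m 1)%R} /\
  {in msupp h, forall m : 'X_{1..2}, exists2 m' : 'X_{1..2}, m' \in msupp h' &
     (m' 0 = m 0 /\ n + m' 1 = m 0 + m 1)%R}.
Proof.
rewrite -['X_1 ^+ n]mul1r -[1](expr0 'X_0) -mpolyX2E.
case/(comp_mpoly_monomial comp_blowupNX).
  move=> m1 m2 _ _ /= E; have := congr1 (fun m : 'X_{1..2} => (m 0%R, m 1%R)) E.
  by rewrite /= !mnm2E => -[e0 e1]; apply: mnm2P; lia.
move=> H1 H2; split=> m mh; [have [m2 m2h E] := H1 m mh|have [m2 m2h E] := H2 m mh];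
  exists m2 => //; have := congr1 (fun m : 'X_{1..2} => (m 0%R, m 1%R)) E;
  by rewrite /= !mnmDE !mnm2E => -[].
Qed.

(** In either chart a monomial of degree s pulls back to a multiple of the s-th power of the
    exceptional equation, so the divisibility holds term by term. *)
Lemma comp_blowup_dvd h n o :
  {in msupp h, forall m, (n <= mdeg m)%N} ->
  exists h', h \mPo blowup_chart o = exceptional_eq o ^+ n * h'.
Proof.
move=> degh; rewrite comp_mpolyEX big_seq.
apply: (big_rec (fun p => exists h', p = exceptional_eq o ^+ n * h')).
  by exists 0; rewrite mulr0.
move=> m p mh [h' ->]; have := degh m mh; rewrite mdeg2E => /subnKC E.
rewrite comp_blowupX -E; case: o => [c|] /=.
  exists ((h@_m)%:MP * ('X_0 ^+ (m 0%R + m 1%R - n) * ('X_1 + c%:MP) ^+ m 1%R) + h').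
  by rewrite -mul_mpolyC exprD; ring.
exists ((h@_m)%:MP * ('X_0 ^+ m 0%R * 'X_1 ^+ (m 0%R + m 1%R - n)) + h').
by rewrite -mul_mpolyC exprD; ring.
Qed.

End Branch.

(** * The conductor condition along the resolution *)

Section Resolution.
Context {K : closedFieldType}.
Implicit Types (f h e : {mpoly K[2]}) (k : K) (a b : nat) (o : option K).
Implicit Types (F G : {mpoly K[3]}) (phi : 3.-tuple {mpoly K[2]}).

Lemma branch_comp_blowup k a b o :
  branch k a b \mPo blowup_chart o =
    match o with
    | Some c => k *: ('X_0 ^+ a - 'X_0 ^+ b * ('X_1 + c%:MP) ^+ b)
    | None => k *: ('X_0 ^+ a * 'X_1 ^+ a - 'X_1 ^+ b)
    end.
Proof.
have brE : branch k a b = k *: ('X_[mnm2 a 0] - 'X_[mnm2 0 b]).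
  by rewrite !mpolyX2E !expr0 mulr1 mul1r.
rewrite brE linearZ linearB /= !comp_blowupX !mnm2E addn0 add0n.
by case: o => [c|]; rewrite !expr0 ?mulr1 ?mul1r.
Qed.

Lemma exceptional_neq0 o n : exceptional_eq o ^+ n != 0 :> {mpoly K[2]}.
Proof.
rewrite expf_neq0 //.
by case: o => [c|]; rewrite /= -msupp_eq0 msuppX.
Qed.

(** As a and b differ, the tangent cone is a multiple line. In every other direction the strict
    transform has a nonzero constant term, hence multiplicity 0; in the tangent direction it is
    again a branch, after one subtractive Euclidean step on (a, b). *)
Lemma strict_transform_branch k a b o f' :
    k != 0 -> (0 < a)%N -> (0 < b)%N -> a != b ->
    branch k a b \mPo blowup_chart o = exceptional_eq o ^+ minn a b * f' ->
  [\/ mult0 f' = 0%N,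
      [/\ (b < a)%N, o = Some 0 & f' = branch k (a - b) b]
    | [/\ (a < b)%N, o = None & f' = branch k a (b - a)]].
Proof.
move=> nzk a0 b0 neab E.
have cancel n (g : {mpoly K[2]}) : n = minn a b ->
    branch k a b \mPo blowup_chart o = exceptional_eq o ^+ n * g -> f' = g.
  by move=> -> E'; apply: (mulfI (exceptional_neq0 o (minn a b))); rewrite -E E'.
have [ltba|ltab|eqab] := ltngtP b a; last by rewrite eqab eqxx in neab.
- have Ea : 'X_0 ^+ a = 'X_0 ^+ b * 'X_0 ^+ (a - b) :> {mpoly K[2]}.
    by rewrite -exprD subnKC // ltnW.
  have Ea' : 'X_1 ^+ a = 'X_1 ^+ b * 'X_1 ^+ (a - b) :> {mpoly K[2]}.
    by rewrite -exprD subnKC // ltnW.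
  case: o E cancel => [c|] E cancel.
    have Ef : f' = k *: ('X_0 ^+ (a - b) - ('X_1 + c%:MP) ^+ b).
      apply: (cancel b); first by lia.
      by rewrite branch_comp_blowup Ea -!mul_mpolyC /=; ring.
    have [c0|nzc] := eqVneq c 0.
      by apply: Or32; split; rewrite ?Ef ?c0 // mpolyC0 addr0.
    apply: Or31; apply: mult0_eq0.
    rewrite Ef mevalZ mevalB !rmorphXn /= mevalD !mevalXU mevalC add0r expr0n.
    by rewrite subn_eq0 leqNgt ltba /= sub0r mulf_neq0 // oppr_eq0 expf_neq0.
  apply: Or31; apply: mult0_eq0.
  rewrite (cancel b (k *: ('X_0 ^+ a * 'X_1 ^+ (a - b) - 1))); first last.
  - by rewrite branch_comp_blowup Ea' -!mul_mpolyC /=; ring.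
  - by lia.
  rewrite mevalZ mevalB mevalM !rmorphXn /= !mevalXU mevalC !expr0n.
  by rewrite subn_eq0 leqNgt ltba /= mulr0 sub0r mulrN1 oppr_eq0.
have Eb : 'X_1 ^+ b = 'X_1 ^+ a * 'X_1 ^+ (b - a) :> {mpoly K[2]}.
  by rewrite -exprD subnKC // ltnW.
have Eb' : 'X_0 ^+ b = 'X_0 ^+ a * 'X_0 ^+ (b - a) :> {mpoly K[2]}.
  by rewrite -exprD subnKC // ltnW.
case: o E cancel => [c|] E cancel; last first.
  apply: Or33; split=> //; apply: (cancel a); first by lia.
  by rewrite branch_comp_blowup Eb /branch -!mul_mpolyC /=; ring.
apply: Or31; apply: mult0_eq0.
rewrite (cancel a (k *: (1 - 'X_0 ^+ (b - a) * ('X_1 + c%:MP) ^+ b))); first last.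
- by rewrite branch_comp_blowup Eb' -!mul_mpolyC /=; ring.
- by lia.
rewrite mevalZ mevalB mevalM !rmorphXn /= mevalD !mevalXU !mevalC !expr0n.
by rewrite subn_eq0 leqNgt ltab /= mul0r subr0 mulr1.
Qed.

(** A monomial of degree at most min(a, b) - 2 has weight at most ab - 2 max(a, b), which is less
    than (a - 1)(b - 1). *)
Lemma conductor_mdeg a b h : (0 < a)%N -> (0 < b)%N -> a != b ->
  conductor a b h -> {in msupp h, forall m, ((minn a b).-1 <= mdeg m)%N}.
Proof.
move=> a0 b0 neab ch m /ch; rewrite mdeg2E; move: (m 0) (m 1) => i j.
move: neab => /eqP neab H; nia.
Qed.

(** Replacing a by a - b and i by i' = i + j - (b - 1) lowers the weight by b(b - 1), and the
    conductor drops by the same amount. *)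
Lemma conductor_ineq a b n i i' j : (0 < b)%N -> (b < a)%N ->
  (b.-1 + i' = n)%N -> (n = i + j)%N ->
  ((a - 1) * (b - 1) <= b * i + a * j)%N =
  ((a - b - 1) * (b - 1) <= b * i' + (a - b) * j)%N.
Proof.
move=> b0 ltba <-; move: b0 ltba; case: b => // b _ ltba.
have [c ->] : exists c, a = (c + b).+2 by exists (a - b.+2)%N; lia.
have -> : ((c + b).+2 - b.+1 = c.+1)%N by lia.
rewrite !subn1 /= => E; have E' : (b * (b + i') = b * (i + j))%N by rewrite E.
move: E'; rewrite !mulnDr => E'; lia.
Qed.

Lemma conductor_blowup0 a b h h' : (0 < b)%N -> (b < a)%N ->
  h \mPo blowup_chart (Some 0) = 'X_0 ^+ b.-1 * h' ->
  conductor a b h <-> conductor (a - b) b h'.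
Proof.
move=> b0 ltba /comp_blowup0[H1 H2]; split=> ch m.
  by case/H1 => m' /ch H [E ->]; rewrite -(conductor_ineq b0 ltba E erefl).
by case/H2 => m' /ch H [E E1]; move: H; rewrite E1 -(conductor_ineq b0 ltba E erefl).
Qed.

(** This is the other chart with the two coordinates exchanged, so [conductor_ineq] applies with a
    and b swapped. *)
Lemma conductor_blowupN a b h h' : (0 < a)%N -> (a < b)%N ->
  h \mPo blowup_chart None = 'X_1 ^+ a.-1 * h' ->
  conductor a b h <-> conductor a (b - a) h'.
Proof.
move=> a0 ltab /comp_blowupN[H1 H2]; split=> ch m.
  case/H1 => m' /ch H [-> E]; rewrite [leqLHS]mulnC [leqRHS]addnC.
  by rewrite -(conductor_ineq a0 ltab E (addnC _ _)) mulnC addnC.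
case/H2 => m' /ch H [E0 E]; move: H; rewrite E0 [leqLHS]mulnC [leqRHS]addnC.
by rewrite -(conductor_ineq a0 ltab E (addnC _ _)) [leqLHS]mulnC [leqRHS]addnC.
Qed.

Lemma coprime_subl a b : (b <= a)%N -> coprime (a - b) b = coprime a b.
Proof. by move=> le; rewrite /coprime -{2}(subnK le) !(gcdnC _ b) gcdnDr. Qed.

Lemma coprime_neq a b : coprime a b -> (2 <= minn a b)%N -> a != b.
Proof. by move=> cab m2; apply/eqP => E; move: cab m2; rewrite E /coprime gcdnn; lia. Qed.

(** Sufficiency of the conductor condition: it gives the degree bound that allows division by the
    exceptional equation at each blow-up, and it passes to the quotient. *)
Lemma near_dvd F G :
    (forall i c, (mult0 (F \mPo affine_chart i c) < 2)%N \/
       exists k a b, [/\ k != 0, (0 < a)%N /\ (0 < b)%N, coprime a b,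
         F \mPo affine_chart i c = branch k a b
         & conductor a b (G \mPo affine_chart i c)]) ->
  forall phi f e, near F phi f e -> exists h, G \mPo phi = e * h.
Proof.
move=> chartH phi f e nF.
(* The induction must also control the cofactor: either no further blow-up is allowed, or the strict
   transform is a branch and [h] satisfies its conductor condition. *)
suff [h [-> _]] : exists h, G \mPo phi = e * h /\ ((mult0 f < 2)%N \/
    exists k a b, [/\ k != 0, (0 < a)%N /\ (0 < b)%N, coprime a b,
      f = branch k a b & conductor a b h]) by exists h.
elim: phi f e / nF => [i c|phi f e o f' nF [h [Gphi H]] m2 Ef'].
  by exists (G \mPo affine_chart i c); rewrite mul1r; split.
case: H => [|[k [a [b [nzk [a0 b0] cab fE ch]]]]]; first by lia.
have mfE : mult0 f = minn a b by rewrite fE mult0_branch.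
have neab : a != b by rewrite coprime_neq // -mfE.
have [h' Eh'] := comp_blowup_dvd o (conductor_mdeg a0 b0 neab ch).
exists h'; rewrite mfE -comp_mpolyA Gphi rmorphM /= Eh' mulrA; split=> //.
move: Ef'; rewrite mfE fE => /(strict_transform_branch nzk a0 b0 neab).
case=> [->|[ltba Eo ->]|[ltab Eo ->]]; [by left|right|right].
  exists k, (a - b)%N, b; rewrite subn_gt0 ltba; split=> //.
    by rewrite (coprime_subl (ltnW ltba)).
  apply/(@conductor_blowup0 a b h h' b0 ltba); last exact: ch.
  by rewrite -Eo Eh' Eo (minn_idPr (ltnW ltba)).
exists k, a, (b - a)%N; rewrite subn_gt0 ltab; split=> //.
  by rewrite coprime_sym (coprime_subl (ltnW ltab)) coprime_sym.
apply/(@conductor_blowupN a b h h' a0 ltab); last exact: ch.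
by rewrite -Eo Eh' Eo (minn_idPl (ltnW ltab)).
Qed.

End Resolution.

(** * Necessity of the conductor condition *)

Section Conductor.
Context {K : closedFieldType}.
Implicit Types (f h e : {mpoly K[2]}) (k : K) (a b : nat) (o : option K).
Implicit Types (F G : {mpoly K[3]}) (phi : 3.-tuple {mpoly K[2]}) (c : 'I_2 -> K).

Lemma comp_blowup0_neq0 e : e != 0 -> e \mPo blowup_chart (Some 0) != 0.
Proof.
move/mlast_supp => es; apply/eqP => E.
have [] := @comp_blowup0 _ e (e \mPo blowup_chart (Some 0)) 0.
  by rewrite expr0 mul1r.
by move=> _ /(_ _ es)[m']; rewrite E msupp0.
Qed.

Lemma comp_blowupN_neq0 e : e != 0 -> e \mPo blowup_chart None != 0.
Proof.
move/mlast_supp => es; apply/eqP => E.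
have [] := @comp_blowupN _ e (e \mPo blowup_chart None) 0.
  by rewrite expr0 mul1r.
by move=> _ /(_ _ es)[m']; rewrite E msupp0.
Qed.

(** Induction on a + b, following the branch through its blow-ups. Adjointness supplies the quotient
    at the next point, the induction hypothesis its conductor condition, and the blow-up equivalence
    carries that condition back. *)
Lemma near_conductor F G :
    (forall phi f e, near F phi f e -> exists h, G \mPo phi = e * h) ->
  forall k a b phi e h, k != 0 -> (0 < a)%N -> (0 < b)%N -> coprime a b ->
    near F phi (branch k a b) e -> e != 0 -> G \mPo phi = e * h ->
  conductor a b h.
Proof.
move=> adjG k a b; move: {-1}(a + b)%N (leqnn (a + b)) => n.
elim: n a b => [|n IHn] a b leabn phi e h nzk a0 b0 cab nF nze Eh; first by lia.
have [m2|m1] := leqP 2 (minn a b); last first.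
  (* With a = 1 or b = 1 the branch is smooth and its conductor is 0. *)
  move=> m _; have [->|->] : (a = 1 \/ b = 1)%N by lia.
    by rewrite subnn mul0n.
  by rewrite subnn muln0.
have neab := coprime_neq cab m2.
have mE := mult0_branch nzk a0 b0.
have [ltba|ltab|eqab] := ltngtP b a; last by rewrite eqab eqxx in neab.
- have nF' : near F [tuple tnth phi j \mPo blowup_chart (Some 0) | j < 3]
      (branch k (a - b) b)
      ((e \mPo blowup_chart (Some 0)) * exceptional_eq (Some (0 : K)) ^+ b.-1).
    rewrite (_ : b.-1 = (mult0 (branch k a b)).-1); last by rewrite mE; lia.
    apply: near_blowup nF _ _; first by rewrite mE.
    rewrite mE (minn_idPr (ltnW ltba)) branch_comp_blowup mpolyC0 addr0 /branch.
    have -> : 'X_0 ^+ a = 'X_0 ^+ b * 'X_0 ^+ (a - b) :> {mpoly K[2]}.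
      by rewrite -exprD subnKC // ltnW.
    by rewrite -!mul_mpolyC /=; ring.
  have [h' Eh'] := adjG _ _ _ nF'.
  have nze' : (e \mPo blowup_chart (Some 0)) != 0 by apply: comp_blowup0_neq0.
  (* The pullback of [e] is nonzero and can be cancelled, leaving a division of the cofactor
     alone. *)
  have E0 : h \mPo blowup_chart (Some 0) = 'X_0 ^+ b.-1 * h'.
    apply: (mulfI nze'); rewrite -rmorphM /= -Eh.
    by rewrite comp_mpolyA Eh' mulrA.
  apply/(conductor_blowup0 b0 ltba E0).
  apply: (IHn _ _ _ _ _ _ nzk _ b0 _ nF' _ Eh'); first by lia.
  - by rewrite subn_gt0.
  - by rewrite (coprime_subl (ltnW ltba)).
  by rewrite mulf_neq0 // exceptional_neq0.
have nF' : near F [tuple tnth phi j \mPo blowup_chart None | j < 3]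
    (branch k a (b - a))
    ((e \mPo blowup_chart None) * exceptional_eq (None : option K) ^+ a.-1).
  rewrite (_ : a.-1 = (mult0 (branch k a b)).-1); last by rewrite mE; lia.
  apply: near_blowup nF _ _; first by rewrite mE.
  rewrite mE (minn_idPl (ltnW ltab)) branch_comp_blowup /branch.
  have -> : 'X_1 ^+ b = 'X_1 ^+ a * 'X_1 ^+ (b - a) :> {mpoly K[2]}.
    by rewrite -exprD subnKC // ltnW.
  by rewrite -!mul_mpolyC /=; ring.
have [h' Eh'] := adjG _ _ _ nF'.
have nze' : (e \mPo blowup_chart None) != 0 by apply: comp_blowupN_neq0.
have E0 : h \mPo blowup_chart None = 'X_1 ^+ a.-1 * h'.
  apply: (mulfI nze'); rewrite -rmorphM /= -Eh.
  by rewrite comp_mpolyA Eh' mulrA.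
apply/(conductor_blowupN a0 ltab E0).
apply: (IHn _ _ _ _ _ _ nzk a0 _ _ nF' _ Eh'); first by lia.
- by rewrite subn_gt0.
- by rewrite coprime_sym (coprime_subl (ltnW ltab)) coprime_sym.
by rewrite mulf_neq0 // exceptional_neq0.
Qed.

(** * The affine charts of the projective plane *)

Lemma affine_chart_id i c : tnth (affine_chart i c) i = 1.
Proof. by rewrite tnth_mktuple unlift_none. Qed.

Lemma affine_chart_lift i c (j : 'I_2) :
  tnth (affine_chart i c) (lift i j) = (c j)%:MP + 'X_j.
Proof. by rewrite tnth_mktuple liftK. Qed.

Lemma affine_chart0E c : affine_chart 0 c =
  [tuple 1; (c 0)%:MP + 'X_0; (c 1)%:MP + 'X_1].
Proof.
apply: eq_from_tnth => -[[|[|[|//]]] lti].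
- by rewrite (_ : Ordinal lti = 0) ?affine_chart_id; last exact: val_inj.
- rewrite (_ : Ordinal lti = lift 0 (0 : 'I_2)); last exact: val_inj.
  by rewrite affine_chart_lift.
rewrite (_ : Ordinal lti = lift 0 (1 : 'I_2)); last exact: val_inj.
by rewrite affine_chart_lift.
Qed.

Lemma affine_chart1E c : affine_chart 1 c =
  [tuple (c 0)%:MP + 'X_0; 1; (c 1)%:MP + 'X_1].
Proof.
apply: eq_from_tnth => -[[|[|[|//]]] lti].
- rewrite (_ : Ordinal lti = lift 1 (0 : 'I_2)); last exact: val_inj.
  by rewrite affine_chart_lift.
- by rewrite (_ : Ordinal lti = 1) ?affine_chart_id; last exact: val_inj.
rewrite (_ : Ordinal lti = lift 1 (1 : 'I_2)); last exact: val_inj.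
by rewrite affine_chart_lift.
Qed.

Lemma affine_chart2E c : affine_chart 2 c =
  [tuple (c 0)%:MP + 'X_0; (c 1)%:MP + 'X_1; 1].
Proof.
apply: eq_from_tnth => -[[|[|[|//]]] lti].
- rewrite (_ : Ordinal lti = lift 2 (0 : 'I_2)); last exact: val_inj.
  by rewrite affine_chart_lift.
- rewrite (_ : Ordinal lti = lift 2 (1 : 'I_2)); last exact: val_inj.
  by rewrite affine_chart_lift.
by rewrite (_ : Ordinal lti = 2) ?affine_chart_id; last exact: val_inj.
Qed.

Lemma prod_ord3 (R : pzSemiRingType) (E : 'I_3 -> R) :
  \prod_(i < 3) E i = E 0 * E 1 * E 2.
Proof.
rewrite !big_ord_recl big_ord0 mulr1 mulrA.
by congr (E _ * E _ * E _); apply: val_inj.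
Qed.

Lemma comp_mpoly3X (R : comNzRingType) n (t : 3.-tuple {mpoly R[n]}) (m : 'X_{1..3}) :
  'X_[m] \mPo t = tnth t 0 ^+ m 0%R * tnth t 1 ^+ m 1%R * tnth t 2 ^+ m 2%R.
Proof. by rewrite comp_mpolyX prod_ord3.
Qed.

Lemma homog_mdeg n (R : nzRingType) l (p : {mpoly R[n]}) :
  p \is l.-homog -> {in msupp p, forall m, mdeg m = l}.
Proof. by move/dhomogP. Qed.

(** For a form of fixed degree the exponents of X_1 and X_2 determine that of X_0, so setting X_0 =
    1 merges no monomials. *)
Lemma comp_chart0 l G h : G \is l.-homog ->
    G \mPo affine_chart 0 (fun=> 0) = h ->
  {in msupp h, forall n, exists2 m : 'X_{1..3}, m \in msupp G & n = mnm2 (m 1) (m 2)} /\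
  {in msupp G, forall m : 'X_{1..3}, mnm2 (m 1) (m 2) \in msupp h}.
Proof.
move=> /homog_mdeg degG Eh.
have XE m : 'X_[m] \mPo affine_chart 0 (fun=> 0) = 'X_[mnm2 (m 1) (m 2)] :> {mpoly K[2]}.
  rewrite comp_mpoly3X affine_chart0E !(tnth_nth 0) /= mpolyC0 !add0r mpolyX2E.
  by rewrite expr1n mul1r.
have [||H1 H2] := @comp_mpoly_monomial _ _ _ G _ _ XE _ 0%MM h.
- move=> m1 m2 /degG d1 /degG d2 E.
  have := congr1 (fun m : 'X_{1..2} => (m 0%R, m 1%R)) E.
  rewrite /= !mnm2E => -[e1 e2]; move: d1 d2; rewrite !mdeg3E => d1 d2.
  by apply: mnm3P; lia.
- by rewrite mpolyX0 mul1r.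
split=> n nh; first by have [m mG] := H1 n nh; rewrite add0m; exists m.
by have [m mh] := H2 n nh; rewrite add0m => <-.
Qed.

Lemma comp_chart2 l G h : G \is l.-homog ->
    G \mPo affine_chart 2 (fun=> 0) = h ->
  {in msupp h, forall n, exists2 m : 'X_{1..3}, m \in msupp G & n = mnm2 (m 0) (m 1)} /\
  {in msupp G, forall m : 'X_{1..3}, mnm2 (m 0) (m 1) \in msupp h}.
Proof.
move=> /homog_mdeg degG Eh.
have XE m : 'X_[m] \mPo affine_chart 2 (fun=> 0) = 'X_[mnm2 (m 0) (m 1)] :> {mpoly K[2]}.
  rewrite comp_mpoly3X affine_chart2E !(tnth_nth 0) /= mpolyC0 !add0r mpolyX2E.
  by rewrite expr1n mulr1.
have [||H1 H2] := @comp_mpoly_monomial _ _ _ G _ _ XE _ 0%MM h.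
- move=> m1 m2 /degG d1 /degG d2 E.
  have := congr1 (fun m : 'X_{1..2} => (m 0%R, m 1%R)) E.
  rewrite /= !mnm2E => -[e1 e2]; move: d1 d2; rewrite !mdeg3E => d1 d2.
  by apply: mnm3P; lia.
- by rewrite mpolyX0 mul1r.
split=> n nh; first by have [m mG] := H1 n nh; rewrite add0m; exists m.
by have [m mh] := H2 n nh; rewrite add0m => <-.
Qed.

End Conductor.

Definition mnm3 (i j k : nat) : 'X_{1..3} := [multinom [tuple i; j; k]].

Lemma mnm3E (i j k : nat) :
  (mnm3 i j k 0 = i) * (mnm3 i j k 1 = j) * (mnm3 i j k 2 = k).
Proof. by rewrite !multinomE. Qed.

Lemma mnm3K (m : 'X_{1..3}) : m = mnm3 (m 0) (m 1) (m 2).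
Proof. by apply: mnm3P; rewrite mnm3E. Qed.

Lemma mpolyX3E (R : nzRingType) (i j k : nat) :
  'X_[mnm3 i j k] = 'X_0 ^+ i * 'X_1 ^+ j * 'X_2 ^+ k :> {mpoly R[3]}.
Proof.
rewrite !mpolyXn -!mpolyXD; congr 'X_[_].
by apply: mnm3P; rewrite !mnmDE !mulmnE !mnm1E !mnm3E /= ?mul0n ?mul1n ?addn0.
Qed.

(** * The equation of the curve *)

Section CurveForm.
Context {K : closedFieldType}.
Variables u d : nat.

Definition curve_form : {mpoly K[3]} := 'X_1 ^+ d - 'X_0 ^+ (d - u) * 'X_2 ^+ u.

Lemma curve_form_mnm3 :
  curve_form = 'X_[mnm3 0 d 0] - 'X_[mnm3 (d - u) 0 u].
Proof. by rewrite !mpolyX3E !expr0 !mulr1 mul1r. Qed.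

Hypotheses (lt0u : (0 < u)%N) (ltud : (u < d)%N) (cop : coprime u d).

Lemma curve_form_homog : curve_form \is d.-homog.
Proof.
by rewrite curve_form_mnm3; apply: rpredB; rewrite dhomogX /= mdeg3E !mnm3E; apply/eqP; lia.
Qed.

Lemma curve_form_neq0 : curve_form != 0.
Proof.
have: mnm3 0 d 0 \in msupp curve_form.
  rewrite curve_form_mnm3 mcoeff_msupp mcoeffB !mcoeffX eqxx.
  have -> : (mnm3 (d - u) 0 u == mnm3 0 d 0) = false.
    by apply/eqP => /(congr1 (fun m : 'X_{1..3} => m 2%R)); rewrite !mnm3E; lia.
  by rewrite subr0 oner_neq0.
by apply: contraTneq => ->; rewrite msupp0.
Qed.

(** The exponent of the normal form of X^m modulo [curve_form], with X_1^d as leading term. *)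
Definition reduced_mnm (m : 'X_{1..3}) : 'X_{1..3} :=
  mnm3 (m 0%R + (d - u) * (m 1%R %/ d)) (m 1%R %% d) (m 2%R + u * (m 1%R %/ d)).

Lemma mpolyX_reduced (m : 'X_{1..3}) :
  exists H, 'X_[m] = 'X_[reduced_mnm m] + curve_form * H.
Proof.
set k := (m 1%R %/ d)%N.
have := subrXX ('X_1 ^+ d) ('X_0 ^+ (d - u) * 'X_2 ^+ u : {mpoly K[3]}) k.
rewrite -/curve_form; set H := \sum_(i < k) _ => E.
exists ('X_[mnm3 (m 0) (m 1%R %% d) (m 2)] * H).
rewrite mulrCA -E [X in 'X_[X] = _](mnm3K m) /reduced_mnm !mpolyX3E -/k.
have -> : 'X_1 ^+ m 1%R = 'X_1 ^+ (m 1%R %% d) * ('X_1 ^+ d) ^+ k :> {mpoly K[3]}.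
  by rewrite -exprM -exprD mulnC addnC -divn_eq.
by rewrite !exprD exprMn -!exprM; ring.
Qed.

(** The weight is the exponent of t_1 after parametrization. Modulo d it determines u m_1, hence m_1
    because u is prime to d and m_1 < d; then m_2 follows, and m_0 by the degree. *)
Lemma reduced_mnm_inj (n : nat) (m m' : 'X_{1..3}) :
  mdeg m = n -> mdeg m' = n -> (m 1%R < d)%N -> (m' 1%R < d)%N ->
  (u * m 1%R + d * m 2%R = u * m' 1%R + d * m' 2%R)%N -> m = m'.
Proof.
rewrite !mdeg3E => dm dm' l1 l1' E.
suff e1 : m 1 = m' 1.
  have e2 : m 2 = m' 2 by apply/eqP; rewrite -(eqn_pmul2l (_ : 0 < d)%N); lia.
  by apply: mnm3P; lia.
have key i j a b : (i <= j)%N -> (j < d)%N -> (u * i + d * a = u * j + d * b)%N -> i = j.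
  move=> leij ltj Eij.
  have: (d %| u * (j - i))%N.
    by apply/dvdnP; exists (a - b)%N; rewrite mulnBr mulnBl; lia.
  rewrite Gauss_dvdr ?(coprime_sym d) // => /dvdn_leq; lia.
have [le|/ltnW le] := leqP (m 1%R) (m' 1%R); first exact: key le l1' E.
by apply/esym/(key _ _ _ _ le l1 (esym E)).
Qed.

Lemma curve_form_vanish (t : 'I_2 -> K) (c : K) (v : 'I_3 -> K) :
  (forall j, v j = c * (tnth (param K u d) j).@[t]) -> curve_form.@[v] = 0.
Proof.
move=> vE.
have vE' : (v 0 = c * t 0 ^+ d) * (v 1 = c * (t 0 ^+ (d - u) * t 1 ^+ u)) *
           (v 2 = c * t 1 ^+ d).
  by rewrite !vE !(tnth_nth 0) /= rmorphM !rmorphXn /= !mevalXU.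
rewrite mevalB mevalM !rmorphXn /= !mevalXU !vE' !exprMn -!exprM.
rewrite (mulnC d) (mulnC d u) mulrACA -exprD subnK ?(ltnW ltud) //.
by rewrite subrr.
Qed.

(** On the points (1 : x^u : x^d) the monomials of a reduced form become distinct powers of x, so a
    nonzero form gives a nonzero polynomial in x, which has a nonroot in an algebraically closed
    field. *)
Lemma vanish_reduced_eq0 (n : nat) (R : {mpoly K[3]}) :
  {in msupp R, forall m : 'X_{1..3}, mdeg m = n /\ (m 1%R < d)%N} ->
  (forall v, curve u d v -> R.@[v] = 0) -> R = 0.
Proof.
move=> suppR vanR; apply/eqP/negP => /negP/mlast_supp m0R.
pose w (m : 'X_{1..3}) := (u * m 1%R + d * m 2%R)%N.
pose Q : {poly K} := \sum_(m <- msupp R) R@_m *: 'X^(w m).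
have Q0 : Q = 0.
  apply/eqP/negP => /negP/closed_nonrootP[x] /negP; apply; apply/rootP.
  pose t (i : 'I_2) : K := if i == 0 then 1 else x.
  pose v (j : 'I_3) : K := (tnth (param K u d) j).@[t].
  have vE : (v 0 = 1) * (v 1 = x ^+ u) * (v 2 = x ^+ d).
    by rewrite /v !(tnth_nth 0) /= mevalM !rmorphXn /= !mevalXU /t /= !expr1n mul1r.
  have <- : R.@[v] = Q.[x].
    rewrite mevalE horner_sum; apply: eq_bigr => m _; rewrite hornerZ hornerXn.
    by rewrite prod_ord3 !vE expr1n mul1r -!exprM -exprD.
  apply: vanR; exists t, 1.
  by split; rewrite ?oner_neq0 // => j; rewrite mul1r.
have: Q`_(w (mlast R)) = R@_(mlast R).
  rewrite coef_sum (bigD1_seq (mlast R)) ?msupp_uniq //= coefZ coefXn eqxx mulr1.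
  rewrite big1_seq ?addr0 // => m /andP[nm mR]; rewrite coefZ coefXn.
  have [E|] := eqVneq; last by rewrite mulr0.
  have [dm lm] := suppR m mR; have [d0 l0] := suppR _ m0R.
  by rewrite (reduced_mnm_inj dm d0 lm l0 (esym E)) eqxx in nm.
by rewrite Q0 coef0 => /esym/eqP; rewrite mcoeff_eq0 m0R.
Qed.

(** A form vanishing on the curve is congruent modulo [curve_form] to a reduced form of the same
    degree, which also vanishes on the curve and is therefore 0. *)
Lemma curve_form_defining : defining_form (curve u d) curve_form.
Proof.
split; first by exists d; apply: curve_form_homog.
move=> n G homG; split=> [vanG|[H ->] v [t [c [_ _ vE]]]]; last first.
  by rewrite mevalM (curve_form_vanish vE) mul0r.
have redG (s : seq 'X_{1..3}) : exists H,
    \sum_(m <- s) G@_m *: 'X_[m] =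
    \sum_(m <- s) G@_m *: 'X_[reduced_mnm m] + curve_form * H.
  elim: s => [|m s [H IH]]; first by exists 0; rewrite !big_nil mulr0 addr0.
  have [H' E] := mpolyX_reduced m; exists (G@_m *: H' + H).
  by rewrite !big_cons IH E -!mul_mpolyC; ring.
have [H E] := redG (msupp G); rewrite -mpolyE in E.
set R := \sum_(m <- _) _ in E.
suff R0 : R = 0 by exists H; rewrite E R0 add0r.
apply: (@vanish_reduced_eq0 n) => [m' /msupp_sum_mpolyX[m mG ->]|v Cv].
  rewrite -(homog_mdeg homG mG) !mdeg3E /reduced_mnm !mnm3E ltn_pmod; last by lia.
  split=> //; rewrite mulnBl; move: (leq_mul (ltnW ltud) (leqnn (m 1%R %/ d))).
  move: (divn_eq (m 1%R) d); move: (m 1%R %/ d)%N (m 1%R %% d)%N => k r; lia.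
have /eqP := vanG v Cv; rewrite E mevalD mevalM.
case: (Cv) => t [c [_ _ vE]].
by rewrite (curve_form_vanish vE) mul0r addr0 => /eqP.
Qed.

(** Two generators of the same ideal divide each other; their quotient is a unit of the polynomial
    ring, and comparing sizes shows that it is constant. *)
Lemma defining_form_unique (F : {mpoly K[3]}) :
  defining_form (curve u d) F -> exists2 k, k != 0 & F = k *: curve_form.
Proof.
case=> [[n homF] genF].
have [H EH] : exists H, curve_form = F * H.
  apply/(genF d _ curve_form_homog) => v [t [c [_ _ vE]]].
  exact: curve_form_vanish vE.
have [_ gen] := curve_form_defining.
have [H' EH'] : exists H', F = curve_form * H'.
  by apply/(gen n _ homF)/(genF n _ homF); exists 1; rewrite mulr1.
have HH1 : H' * H = 1.
  apply: (mulfI curve_form_neq0); rewrite mulr1 mulrA -EH' -EH //.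
have nzH : H' != 0 by apply: contraTneq (oner_neq0 {mpoly K[3]}) => E;
  rewrite -HH1 E mul0r eqxx.
have nzH2 : H != 0 by apply: contraTneq (oner_neq0 {mpoly K[3]}) => E;
  rewrite -HH1 E mulr0 eqxx.
have sz := msizeM nzH nzH2.
have [k nzk Ek] : exists2 k, k != 0 & H' = k%:MP.
  apply/msize_poly1P; move: sz nzH nzH2; rewrite HH1 msize1 -!msize_poly_eq0.
  by move: (msize H') (msize H) => [|[|i]] [|[|j]] //= /eqP; rewrite !addSn !addnS.
by exists k => //; rewrite EH' Ek mulrC mul_mpolyC.
Qed.

End CurveForm.

(** * Singular points and the adjoint criterion *)

Section AdjointCriterion.
Context {K : closedFieldType}.
Implicit Types (k : K) (c : 'I_2 -> K).

Lemma mderivXn n (R : comNzRingType) (i : 'I_n) (p : {mpoly R[n]}) r :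
  (p ^+ r)^`M(i) = r%:R * p ^+ r.-1 * p^`M(i).
Proof.
elim: r => [|r IH]; first by rewrite expr0 -mpolyC1 mderivC !mul0r.
rewrite exprS mderivM IH /= -natr1; case: r {IH} => [|r]; last by rewrite exprS; ring.
by rewrite !expr0; ring.
Qed.

Lemma mderiv_shift c (i j : 'I_2) :
  ((c j)%:MP + 'X_j : {mpoly K[2]})^`M(i) = (i == j)%:R.
Proof.
rewrite mderivD mderivC add0r mderivX mnm1E eq_sym.
have [->|_] := eqVneq i j; last by rewrite scale0r.
have -> : (U_(j) - U_(j) = 0 :> 'X_{1..2})%MM.
  by apply/mnmP => l; rewrite mnmBE subnn mnm0E.
by rewrite mpolyX0 scale1r.
Qed.

Lemma comp_curve_form u d (t : 3.-tuple {mpoly K[2]}) :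
  curve_form u d \mPo t = tnth t 1 ^+ d - tnth t 0 ^+ (d - u) * tnth t 2 ^+ u.
Proof.
by rewrite rmorphB rmorphM !rmorphXn /= !comp_mpolyXU -!tnth_nth.
Qed.

(** Jacobian criterion chart by chart; d and d - u are nonzero in K by characteristic zero. The
    conclusion equates charts rather than [c] with the zero function, which would require functional
    extensionality. *)
Lemma curve_form_smooth (charK : [pchar K] =i pred0) u d k (i : 'I_3) c :
    (0 < u)%N -> (u.+1 < d)%N -> k != 0 ->
    (2 <= mult0 ((k *: curve_form u d) \mPo affine_chart i c))%N ->
  affine_chart i c = affine_chart i (fun=> 0) /\ (i = 0 \/ i = 2).
Proof.
move=> u0 ltud nzk; set f := _ \mPo _ => mf.
have nat_neq0 r : (0 < r)%N -> (r%:R : K) != 0.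
  by rewrite lt0n (proj1 (pcharf0P K) charK).
have [fv _] := mult0_ge2 0 mf.
have fd j := (mult0_ge2 j mf).2.
have Z p : k *: p = f -> p.@[fun=> 0] = 0 /\ forall j, (p^`M(j)).@[fun=> 0] = 0.
  move=> E; split=> [|j]; [move: fv|move: (fd j)]; rewrite -E ?mderivZ mevalZ => /eqP;
  by rewrite mulf_eq0 (negPf nzk) => /eqP.
have [E0 Ed] := Z _ (esym (comp_mpolyZ _ _ _)).
move: E0 (Ed 0) (Ed 1); clear fv fd Z Ed; rewrite /= comp_curve_form.
have sh j : ((c j)%:MP + 'X_j : {mpoly K[2]}).@[fun=> 0] = c j.
  by rewrite mevalD mevalC mevalXU addr0.
case: i {mf f} => [[|[|[|//]]] lti].
- rewrite (_ : Ordinal lti = 0); last exact: val_inj.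
  rewrite affine_chart0E !(tnth_nth 0) /= expr1n mul1r !mderivB !mderivXn !mderiv_shift.
  rewrite !mulr0 mulr1 subr0 !rmorphB !rmorphM !rmorphXn /= !sh rmorph_nat.
  move=> Ev /eqP; rewrite mulf_eq0 (negPf (nat_neq0 _ _)) ?expf_eq0 /=; last by lia.
  case/andP => _ /eqP c0 _; move: Ev; rewrite c0 expr0n.
  rewrite (_ : (d == 0)%N = false) ?sub0r; last by lia.
  move/eqP; rewrite oppr_eq0 expf_eq0 => /andP[_ /eqP c1].
  by rewrite c1; split=> //; [exact/esym/affine_chart0E|left].
(* The chart X_1 = 1 has no singular point: a vanishing derivative makes a coordinate zero, and the
   equation then reads 1 = 0. *)
- rewrite (_ : Ordinal lti = 1); last exact: val_inj.
  rewrite affine_chart1E !(tnth_nth 0) /= expr1n !mderivB !mderivM !mderivXn !mderiv_shift.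
  rewrite !mulr0 !mulr1 !addr0 -mpolyC1 mderivC sub0r.
  rewrite !(rmorphB, rmorphN, rmorphM, rmorphXn) /= !sh rmorph_nat mevalC.
  move=> Ev /eqP; rewrite oppr_eq0 !mulf_eq0 (negPf (nat_neq0 _ _)) ?expf_eq0 /=; last by lia.
  case/orP => /andP[_ /eqP c0]; move: Ev; rewrite c0 expr0n.
    rewrite (_ : (d - u == 0)%N = false) ?mul0r ?subr0; last by lia.
    by move/eqP; rewrite oner_eq0.
  rewrite (_ : (u == 0)%N = false) ?mulr0 ?subr0; last by lia.
  by move/eqP; rewrite oner_eq0.
rewrite (_ : Ordinal lti = 2); last exact: val_inj.
rewrite affine_chart2E !(tnth_nth 0) /= expr1n mulr1 !mderivB !mderivXn !mderiv_shift.
rewrite !mulr0 !mulr1 sub0r subr0 !(rmorphB, rmorphN, rmorphM, rmorphXn) /= !sh !rmorph_nat.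
move=> Ev _ /eqP; rewrite mulf_eq0 (negPf (nat_neq0 _ _)) ?expf_eq0 /=; last by lia.
case/andP => _ /eqP c1; move: Ev; rewrite c1 expr0n.
rewrite (_ : (d == 0)%N = false) ?sub0r; last by lia.
move/eqP; rewrite oppr_eq0 expf_eq0 => /andP[_ /eqP c0].
by rewrite c0; split=> //; [exact/esym/affine_chart2E|right].
Qed.

Lemma curve_form_chart0 u d k :
  (k *: curve_form u d) \mPo affine_chart 0 (fun=> 0) = branch k d u.
Proof.
rewrite comp_mpolyZ comp_curve_form affine_chart0E !(tnth_nth 0) /= mpolyC0.
by rewrite !add0r expr1n mul1r.
Qed.

Lemma curve_form_chart2 u d k :
  (k *: curve_form u d) \mPo affine_chart 2 (fun=> 0) = branch (- k) (d - u) d.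
Proof.
rewrite comp_mpolyZ comp_curve_form affine_chart2E !(tnth_nth 0) /= mpolyC0.
by rewrite !add0r expr1n mulr1 /branch scaleNr -scalerN opprB.
Qed.

(** These are the conductor conditions at (1:0:0), with branch X_1^d = X_2^u, and at (0:0:1), with
    branch X_0^(d-u) = X_1^d. *)
Definition adjoint_mnm u d (m : 'X_{1..3}) : bool :=
  ((d - 1) * (u - 1) <= u * m 1%R + d * m 2%R)%N &&
  ((d - u - 1) * (d - 1) <= d * m 0%R + (d - u) * m 1%R)%N.

(** Necessity follows the two singular branches, for whichever scalar multiple of [curve_form] is
    given; sufficiency uses [curve_form] itself, since every other point has multiplicity below
    2. *)
Lemma adjointP (charK : [pchar K] =i pred0) u d l (G : {mpoly K[3]}) :
    (1 < u)%N -> (2 * u < d)%N -> coprime u d -> G \is l.-homog ->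
  adjoint (curve u d) G <-> {in msupp G, forall m, adjoint_mnm u d m}.
Proof.
move=> lt1u ltud cop homG.
have u0 : (0 < u)%N by lia.
have d0 : (0 < d)%N by lia.
have ltud' : (u < d)%N by lia.
have ltud1 : (u.+1 < d)%N by lia.
have du0 : (0 < d - u)%N by lia.
have cdu : coprime d u by rewrite coprime_sym.
have cdu' : coprime (d - u) d.
  by rewrite /coprime -{2}(subnK (ltnW ltud')) gcdnDl -/(coprime _ _)
             (coprime_subl (ltnW ltud')).
have [S0 S0'] := comp_chart0 homG erefl; have [S2 S2'] := comp_chart2 homG erefl.
split=> [[F dF adjG] m mG|suppG].
  have [k nzk EF] := defining_form_unique u0 ltud' cop dF.
  have nzk' : - k != 0 by rewrite oppr_eq0.
  apply/andP; split.
    have nF : near F (affine_chart 0 (fun=> 0)) (branch k d u) 1.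
      by rewrite -curve_form_chart0 -EF; apply: near_proper.
    have := near_conductor adjG nzk d0 u0 cdu nF (oner_neq0 _) (esym (mul1r _)).
    by move/(_ _ (S0' m mG)); rewrite !mnm2E.
  have nF : near F (affine_chart 2 (fun=> 0)) (branch (- k) (d - u) d) 1.
    by rewrite -curve_form_chart2 -EF; apply: near_proper.
  have := near_conductor adjG nzk' du0 d0 cdu' nF (oner_neq0 _) (esym (mul1r _)).
  by move/(_ _ (S2' m mG)); rewrite !mnm2E.
exists (curve_form u d); first exact: curve_form_defining.
apply: near_dvd => i c; rewrite -[curve_form u d]scale1r.
have [lt2|ge2] := ltnP (mult0 ((1 *: curve_form u d) \mPo affine_chart i c)) 2.
  by left.
right; have [-> [->|->]] := curve_form_smooth charK u0 ltud1 (oner_neq0 K) ge2.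
  exists 1, d, u; rewrite oner_neq0 curve_form_chart0; split=> // n /S0[m mG ->].
  by rewrite !mnm2E; have /andP[] := suppG m mG.
exists (-1), (d - u)%N, d; rewrite oppr_eq0 oner_neq0 curve_form_chart2.
split=> // n /S2[m mG ->].
by rewrite !mnm2E; have /andP[] := suppG m mG.
Qed.

End AdjointCriterion.

(** * The subtractive Euclidean algorithm *)

Section EuclideanAlgorithm.
Variables u d : nat.

Definition euclid_init : euclid_state := EuclidState (d%:Z - u%:Z) u%:Z 0 1 1 0.

(** Both b and c are integer combinations of u and d - u, and each step is unimodular up to a swap.
    Corresponding coefficients have opposite signs in the weak sense, so the subtractions add
    absolute values and the sign pattern persists. *)
Definition euclid_inv (s : euclid_state) : Prop :=
  let: EuclidState b c si ta al be := s in
  [/\ b = u%:Z * si + (d%:Z - u%:Z) * ta, c = u%:Z * al + (d%:Z - u%:Z) * be,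
      `|si * be - ta * al| = 1
    & [/\ si <= 0, 0 < ta, 0 < al & be <= 0] \/
      [/\ al <= 0, 0 < be, 0 < si & ta <= 0]].

Lemma state_inv n : euclid_inv (state u d n).
Proof.
rewrite /state; elim: n.-1 => [|r]; first by split; rewrite ?mulr0 ?mulr1 ?add0r ?addr0 //; left.
rewrite iterS; case: (iter r _ _) => b c si ta al be [Eb Ec det sg] /=.
case: ifP => _; split=> //; try (by rewrite Eb Ec; ring); try lia.
- by case: sg => -[s1 s2 s3 s4]; [left|right]; split=> //; lia.
- by case: sg => -[s1 s2 s3 s4]; [right|left]; split=> //; lia.
Qed.

(** The bound keeps the difference at least y through all r steps, so no swap occurs. *)
Lemma iter_state_step r (x y : nat) s :
    st_b s = x%:Z -> st_c s = y%:Z -> (r * y + y <= x)%N ->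
  st_b (iter r state_step s) = (x - r * y)%N%:Z /\
  st_c (iter r state_step s) = y%:Z.
Proof.
move=> Eb Ec; elim: r => [|r IH] le; first by rewrite /= Eb Ec mul0n subn0.
have [] := IH; first by lia.
rewrite iterS; case: (iter r _ _) => b c si ta al be /= -> ->.
by case: ifP => [_|/negP]; [split=> //=; lia|lia].
Qed.

Variables (p : nat) (a qt : nat -> nat).
Hypotheses (euclid : euclidean_data u d p a qt).
Hypotheses (lt0u : (0 < u)%N) (ltud : (2 * u < d)%N) (cop : coprime u d).

Lemma euclid_lt i : (0 < i <= p)%N -> (a i < a i.-1)%N.
Proof.
have [a0 a1 step _] := euclid; case: i => // -[|i] /= lei; first by rewrite a0 a1; lia.
by have [] := step i.+1 isT lei.
Qed.

Lemma euclid_qt_gt0 i : (0 < i < p)%N -> (0 < qt i)%N.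
Proof.
move=> /andP[i0 ip]; have [_ _ step _] := euclid; have [E lt] := step i i0 ip.
have := euclid_lt (_ : 0 < i <= p)%N; rewrite i0 (ltnW ip) => /(_ isT).
by case: (qt i) E => //; lia.
Qed.

Lemma euclid_coprime i : (0 < i <= p)%N -> coprime (a i.-1) (a i).
Proof.
have [a0 a1 step _] := euclid; elim: i => // -[|i] IH lei /=.
  have leud : (u <= d)%N by lia.
  by rewrite a0 a1 (coprime_subl leud) coprime_sym.
have [E _] := step i.+1 isT lei; have := IH (ltnW lei).
by rewrite /= in E *; rewrite E coprime_sym /coprime gcdnMDl.
Qed.

Lemma euclid_p_gt1 : (1 < p)%N.
Proof. by have [a0 a1 _ ap] := euclid; case: p ap => [|[|]] //; rewrite ?a0 ?a1; lia. Qed.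

(** A division with quotient q_i amounts to q_i - 1 subtractions without swap, followed by one that
    swaps because the remainder is below a_i. *)
Lemma euclid_iter i : (0 < i < p)%N ->
  let s := iter (\sum_(1 <= j < i) qt j) state_step euclid_init in
  st_b s = (a i.-1)%:Z /\ st_c s = (a i)%:Z.
Proof.
have [a0 a1 step _] := euclid.
elim: i => // -[|i] IH lei /=.
  by rewrite big_geq //= a0 a1; lia.
have lei' : (0 < i.+1 < p)%N by rewrite /= ltnW.
have [E lt] := step i.+1 isT (ltnW lei).
have q0 := euclid_qt_gt0 lei'; rewrite big_nat_recr //= addnC.
have [] := IH lei'; set s := iter _ _ _ => Eb Ec.
rewrite iterD -/s -(prednK q0) iterS.
have [] := @iter_state_step (qt i.+1).-1 _ _ s Eb Ec.
  by rewrite E /= addnC -mulSn prednK // leq_addr.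
rewrite /= in E *; rewrite E; case: (iter _ _ _) => b c si ta al be /= -> ->.
have -> : (qt i.+1 * a i.+1 + a i.+2 - (qt i.+1).-1 * a i.+1 = a i.+1 + a i.+2)%N.
  by rewrite -{1}(prednK q0) mulSn; lia.
by case: ifP => [|_]; [lia|split=> //=; lia].
Qed.

(** The last nonzero remainder is gcd = 1, so the last division starts at (q_(p-1), 1) and reaches
    (1, 1) after q_(p-1) - 1 steps. As [state] is indexed from 1, this is the state of index q. *)
Lemma euclid_last (q := euclidean_q p qt) :
  [/\ (0 < q)%N, st_b (state u d q) = 1 & st_c (state u d q) = 1].
Proof.
have p1 := euclid_p_gt1; have [_ _ step ap] := euclid.
have lep : (0 < p.-1 < p)%N by lia.
have q0 := euclid_qt_gt0 lep; have [] := euclid_iter lep.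
have /andP[i0 ip] := lep; have [E _] := step _ i0 ip.
have := euclid_coprime (_ : 0 < p <= p)%N; rewrite leqnn (ltnW p1) => /(_ isT).
rewrite ap /coprime gcdn0 => /eqP a1; rewrite prednK ?ap ?a1 ?muln1 ?addn0 in E *; last by lia.
have qE : q = (\sum_(1 <= j < p.-1) qt j + qt p.-1)%N.
  by rewrite /q /euclidean_q -{1}(prednK (ltnW p1)) big_nat_recr.
rewrite E; set s := iter _ _ _ => Eb Ec.
have [] := @iter_state_step (qt p.-1).-1 _ _ s Eb Ec; first by lia.
rewrite /state qE -iterD.
have -> : ((qt p.-1).-1 + \sum_(1 <= j < p.-1) qt j =
           (\sum_(1 <= j < p.-1) qt j + qt p.-1).-1)%N by lia.
by rewrite -/euclid_init => -> ->; split=> //; lia.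
Qed.

(** At index q both coefficient pairs solve u s + (d - u) t = 1, since b = c = 1. The next step
    swaps because b - c = 0 < c, so the pair at index q + 1 is (alpha_q, beta_q). *)
Lemma euclid_sigma_tau (q := euclidean_q p qt)
    (s := sigma u d q) (t := tau u d q) (s' := sigma u d q.+1) (t' := tau u d q.+1) :
  [/\ s <= 0, 0 < t, 0 < s' & t' <= 0] /\
     [/\ s' = s + (d%:Z - u%:Z), t' = t - u%:Z & u%:Z * s + (d%:Z - u%:Z) * t = 1]
  \/
  [/\ s' <= 0, 0 < t', 0 < s & t <= 0] /\
     [/\ s = s' + (d%:Z - u%:Z), t = t' - u%:Z & u%:Z * s + (d%:Z - u%:Z) * t = 1].
Proof.
have [q0] := euclid_last; rewrite -/q => bq cq.
have Eq1 : state u d q.+1 = state_step (state u d q).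
  by rewrite /state -iterS prednK.
move: (state_inv q) bq cq; rewrite /s /t /s' /t' /sigma /tau Eq1.
case: (state u d q) => b c si ta al be /= [Eb Ec det sg] b1 c1.
rewrite b1 in Eb; rewrite c1 in Ec.
(* Cramer's rule on the two Bezout equations: the difference of the solutions is the determinant,
   which is 1 or -1, times (d - u, -u). *)
have E1 : (d%:Z - u%:Z) * (si * be - ta * al) = si - al.
  have -> : si - al = si * (u%:Z * al + (d%:Z - u%:Z) * be) -
                      al * (u%:Z * si + (d%:Z - u%:Z) * ta) by rewrite -Eb -Ec !mulr1.
  by ring.
have E2 : u%:Z * (si * be - ta * al) = be - ta.
  have -> : be - ta = be * (u%:Z * si + (d%:Z - u%:Z) * ta) -
                      ta * (u%:Z * al + (d%:Z - u%:Z) * be) by rewrite -Eb -Ec !mulr1.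
  by ring.
have {}det : si * be - ta * al = 1 \/ si * be - ta * al = -1 by lia.
rewrite b1 c1 /=; case: sg => -[s1 s2 s3 s4].
  left; split=> //; case: det E1 E2 => -> E1 E2; split; lia.
right; split=> //; case: det E1 E2 => -> E1 E2; split; lia.
Qed.

End EuclideanAlgorithm.

(** A representation of xy - x - y gives x(i + 1) + y(j + 1) = xy. Then y divides i + 1, so x(i + 1)
    is already at least xy. *)
Lemma frobenius_not_repr (x y i j : nat) : coprime x y -> (0 < x)%N -> (0 < y)%N ->
  (x * i + y * j).+1 <> ((x - 1) * (y - 1))%N.
Proof.
move=> cop x0 y0 E.
have E1 : (x * i.+1 + y * j.+1 = x * y)%N.
  by move: E; case: x y x0 y0 {cop} => // x [|y] // _ _; rewrite !subn1 /=; lia.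
have : (y %| x * i.+1)%N.
  by rewrite -(dvdn_addl _ (dvdn_mulr j.+1 (dvdnn y))) E1 dvdn_mull.
rewrite Gauss_dvdr 1?coprime_sym // => /dvdn_leq le'; have {le'}le := le' isT.
have := leq_mul (leqnn x) le; lia.
Qed.

(** * Supports of pencils *)

Section PairSupport.
Context {K : closedFieldType}.
Implicit Types (A B C : {mpoly K[3]}) (mu nu m : 'X_{1..3}) (W : pred 'X_{1..3}).

(** Two terms can cancel only at a monomial divisible by both X^mu and X^nu, and there [W] holds
    anyway. *)
Lemma msupp_pair W A B mu nu :
    (forall m, (mu <= m)%MM -> (nu <= m)%MM -> W m) ->
  {in msupp (A * 'X_[mu] + B * 'X_[nu]), forall m, W m} <->
  {in msupp A, forall m, W (mu + m)%MM} /\ {in msupp B, forall m, W (nu + m)%MM}.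
Proof.
move=> overlap; split=> [suppP|[suppA suppB] m /msuppD_le]; last first.
  rewrite mem_cat !(perm_mem (msuppMX _ _)) => /orP[] /mapP[m' m'P ->].
    exact: suppA.
  exact: suppB.
have key A' B' mu' nu' : (forall m, (mu' <= m)%MM -> (nu' <= m)%MM -> W m) ->
    {in msupp (A' * 'X_[mu'] + B' * 'X_[nu']), forall m, W m} ->
    {in msupp A', forall m, W (mu' + m)%MM}.
  move=> ov suppP' m mA; have lemu : (mu' <= mu' + m)%MM by apply: lem_addr.
  have [lenu|nlenu] := boolP (nu' <= mu' + m)%MM; first exact: ov.
  apply: suppP'; rewrite mcoeff_msupp mcoeffD mcoeffMX [X in _ + X]memN_msupp_eq0.
    by rewrite addr0 -mcoeff_msupp.
  rewrite (perm_mem (msuppMX _ _)); apply: contra nlenu => /mapP[m' _ ->].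
  exact: lem_addr.
split; first exact: key overlap suppP.
apply: (key B A nu mu) => [m l1 l2|]; first exact: overlap.
by rewrite addrC.
Qed.

Lemma mcoeff_form_of l k (a : 'X_{1..3} -> K) m :
  (form_of l k a)@_m = if (mdeg m + k == l)%N then a m else 0.
Proof.
rewrite /form_of big_mkcond /=.
rewrite (eq_bigr (fun m' : 'X_{1..3 < l.+1} =>
    (if (mdeg m' + k == l)%N then a m' else 0) *: 'X_[m'])); last first.
  by move=> m' _; case: ifP => // _; rewrite scale0r.
have [lt|ge] := ltnP (mdeg m) l.+1.
  by rewrite (mcoeff_mpoly (fun m' => if (mdeg m' + k == l)%N then a m' else 0)).
rewrite (_ : (mdeg m + k == l)%N = false); last by apply/eqP; lia.
rewrite raddf_sum big1 //= => m' _; rewrite mcoeffZ mcoeffX.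
have [E|_] := eqVneq (bmnm m') m; last by rewrite mulr0.
by move: (bmdeg m'); rewrite E ltnNge ge.
Qed.

Lemma msupp_form_of l k (a : 'X_{1..3} -> K) (W : pred 'X_{1..3}) :
  {in msupp (form_of l k a), forall m, W m} <->
  forall m, (mdeg m + k = l)%N -> ~~ W m -> a m = 0.
Proof.
split=> [suppW m E nW|vanA m].
  apply/eqP; apply: contraNT nW => nz; apply: suppW.
  by rewrite mcoeff_msupp mcoeff_form_of E eqxx.
rewrite mcoeff_msupp mcoeff_form_of; case: ifP => [/eqP E nz|_]; last by rewrite eqxx.
by apply: contraNT nz => nW; rewrite vanA.
Qed.

Lemma form_of_mulX_homog l k (a : 'X_{1..3} -> K) mu :
  mdeg mu = k -> form_of l k a * 'X_[mu] \is l.-homog.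
Proof.
move=> dmu; apply/dhomogP => m; rewrite (perm_mem (msuppMX _ _)) => /mapP[m' + ->].
rewrite mcoeff_msupp mcoeff_form_of; case: ifP => [/eqP E _|_]; last by rewrite eqxx.
by rewrite /= mdegD dmu addnC.
Qed.

Lemma inSX m : inS ('X_[m] : {mpoly K[3]}) =
  varX K 0 ^+ m 0%R * varX K 1 ^+ m 1%R * varX K 2 ^+ m 2%R.
Proof. by rewrite /inS comp_mpoly3X !tnth_mktuple. Qed.

(** The substitutions (T_0, T_1) = (1, 0) and (0, 1), with the X_j kept, read off the two
    coefficients. *)
Lemma pencil_inj C0 C1 D0 D1 :
  varT K 0 * inS C0 + varT K 1 * inS C1 = varT K 0 * inS D0 + varT K 1 * inS D1 ->
  C0 = D0 /\ C1 = D1.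
Proof.
pose t (b : bool) : 5.-tuple {mpoly K[3]} :=
  [tuple match split (i : 'I_(2 + 3)) with
         | inl k => ((k == 0) == b)%:R | inr j => 'X_j end | i < 5].
have tT b k : varT K k \mPo t b = ((k == 0) == b)%:R.
  by rewrite comp_mpolyXU -tnth_nth tnth_mktuple (unsplitK (inl k)).
have tS b C : inS C \mPo t b = C.
  rewrite /inS comp_mpolyA -[RHS]comp_mpoly_id; congr (_ \mPo _).
  apply: eq_from_tnth => j; rewrite !tnth_mktuple.
  by rewrite comp_mpolyXU -tnth_nth tnth_mktuple (unsplitK (inr j)).
move=> E; have P b := congr1 (comp_mpoly (t b)) E.
split; [move: (P true)|move: (P false)];
  by rewrite !rmorphD !rmorphM /= !tT !tS /= !mul1r !mul0r ?addr0 ?add0r.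
Qed.

End PairSupport.

(** The coefficients of a pencil are unique, and the zero form satisfies the support condition
    vacuously. *)
Lemma pencil_adjointP (K : closedFieldType) (charK : [pchar K] =i pred0) (u d l : nat)
    (C0 C1 : {mpoly K[3]}) :
    (1 < u)%N -> (2 * u < d)%N -> coprime u d -> C0 \is l.-homog -> C1 \is l.-homog ->
  Adj l (curve u d) (varT K 0 * inS C0 + varT K 1 * inS C1) <->
  {in msupp C0, forall m, adjoint_mnm u d m} /\ {in msupp C1, forall m, adjoint_mnm u d m}.
Proof.
move=> lt1u ltud cop h0 h1.
have adjE (C : {mpoly K[3]}) : C \is l.-homog -> C = 0 \/ adjoint (curve u d) C ->
    {in msupp C, forall m, adjoint_mnm u d m}.
  by move=> hC [->|/(adjointP charK lt1u ltud cop hC)//] m; rewrite msupp0.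
split=> [[D0 [D1 [hD0 hD1 adj0 adj1]]]|[supp0 supp1]].
  by move/pencil_inj => -[-> ->]; split; apply: adjE.
by exists C0, C1; split=> //; right;
  [apply/(adjointP charK lt1u ltud cop h0)|apply/(adjointP charK lt1u ltud cop h1)].
Qed.

Definition mu_mnm (u d n : nat) : 'X_{1..3} :=
  mnm3 (absz (sigma u d n)) 0 (absz (tau u d n)).

Definition nu_mnm (u d n : nat) : 'X_{1..3} :=
  mnm3 0 (absz (sigma u d n - tau u d n)) 0.

(** Up to sign the two monomials of F_n are X^mu and X^nu; the sign of sigma_n only decides which of
    them multiplies T_0. *)
Lemma F1E (K : closedFieldType) (u d n : nat) :
  F1 K u d n =
    if sigma u d n <= 0
    then varT K 0 * inS 'X_[mu_mnm u d n] - varT K 1 * inS 'X_[nu_mnm u d n]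
    else varT K 0 * inS 'X_[nu_mnm u d n] - varT K 1 * inS 'X_[mu_mnm u d n].
Proof.
rewrite /F1 !inSX /mu_mnm /nu_mnm !mnm3E !expr0 !mul1r !mulr1 !abszN distnC.
by case: ifP; rewrite -?mulrA.
Qed.

Lemma mul_predn (x y : nat) : (0 < x)%N -> (0 < y)%N ->
  ((x - 1) * (y - 1) + x + y = x * y + 1)%N.
Proof. by case: x y => // x [|y] // _ _; rewrite !subn1 /=; lia. Qed.

(** * Weights of the monomials at the two singular points *)

Section Weights.
Variables u v S T : nat.
Hypotheses (u0 : (0 < u)%N) (v0 : (0 < v)%N).
Hypothesis (det : (v * T = u * S + 1)%N \/ (u * S = v * T + 1)%N).

Let c0 := ((u + v - 1) * (u - 1))%N.
Let c2 := ((v - 1) * (u + v - 1))%N.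

(** With d = u + v, the weights are at least u(S' + T') + dT = ud + (vT - uS) and dS + v(S' + T') =
    vd - (vT - uS). Since vT - uS is 1 or -1, both exceed or equal the conductors. *)
Lemma adjoint_mnm_overlap (S' T' : nat) (m : 'X_{1..3}) :
    (S + S' = v)%N -> (T + T' = u)%N ->
  (mnm3 S 0 T <= m)%MM -> (mnm3 0 (S' + T') 0 <= m)%MM -> adjoint_mnm u (u + v) m.
Proof.
move=> SS' TT' /mnm_lepP le1 /mnm_lepP le2.
move: (le1 0) (le1 2) (le2 1); rewrite !mnm3E => leS leT leST.
have E0 : (c0 + (u + v) + u = (u + v) * u + 1)%N by apply: mul_predn; lia.
have E2 : (c2 + v + (u + v) = v * (u + v) + 1)%N by apply: mul_predn; lia.
rewrite /adjoint_mnm addKn -/c0 -/c2.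
have := leq_mul (leqnn (u + v)) leS; have := leq_mul (leqnn (u + v)) leT.
have := leq_mul (leqnn u) leST; have := leq_mul (leqnn v) leST.
move: E0 E2 det; rewrite -SS' -TT'; move: (m 0) (m 1) (m 2) c0 c2 => i j k c c' *.
by apply/andP; split; lia.
Qed.

(** At each point the weights of mu + m and nu + m differ by vT - uS, which is 1 or -1. If only one
    reached the conductor c, the other would be c - 1, which is not in the semigroup. Hence either
    weight may be tested at either point; the two choices listed are those of conditions (1) and
    (2). *)
Lemma adjoint_mnm_mu_nu (cop : coprime u v) (m : 'X_{1..3}) :
  let mu := mnm3 S 0 T in let nu := mnm3 0 (S + T) 0 in
  adjoint_mnm u (u + v) (mu + m) && adjoint_mnm u (u + v) (nu + m) =
    (c0 <= u * m 1%R + (u + v) * m 2%R + (u + v) * T)%N &&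
    (c2 <= (u + v) * m 0%R + v * m 1%R + v * (S + T))%N /\
  adjoint_mnm u (u + v) (mu + m) && adjoint_mnm u (u + v) (nu + m) =
    (c0 <= u * m 1%R + (u + v) * m 2%R + u * (S + T))%N &&
    (c2 <= (u + v) * m 0%R + v * m 1%R + (u + v) * S)%N.
Proof.
move=> mu nu; rewrite /adjoint_mnm addKn -/c0 -/c2 !mnmDE !mnm3E !add0n.
have copd : coprime (u + v) u by rewrite coprime_sym /coprime gcdnDl.
have copd' : coprime v (u + v).
  by rewrite /coprime gcdnDr -/(coprime _ _) coprime_sym.
have d0 : (0 < u + v)%N by lia.
have F0 := @frobenius_not_repr _ _ (T + m 2%R) (m 1) copd d0 u0.
have F1 := @frobenius_not_repr _ _ (m 2) (S + T + m 1%R) copd d0 u0.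
have F2 := @frobenius_not_repr _ _ (m 1) (S + m 0%R) copd' v0 d0.
have F3 := @frobenius_not_repr _ _ (S + T + m 1%R) (m 0) copd' v0 d0.
rewrite -/c0 -/c2 in F0 F1 F2 F3.
move: F0 F1 F2 F3 det; move: (m 0) (m 1) (m 2) c0 c2 => i j k c c' *.
by split; apply/idP/idP; lia.
Qed.

End Weights.

(** With the signs known, all relations become equations between natural numbers, in the form
    required for exponents. *)
Lemma abs_of_signs (u v : nat) (s t s' t' : int) :
    s <= 0 -> 0 < t -> 0 < s' -> t' <= 0 ->
    s' = s + v%:Z -> t' = t - u%:Z -> u%:Z * s + v%:Z * t = 1 ->
  [/\ (absz s + absz s' = v)%N /\ (absz t + absz t' = u)%N,
      absz (s - t) = (absz s + absz t)%N /\ absz (s' - t') = (absz s' + absz t')%N,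
      (v * absz t = u * absz s + 1)%N & (u * absz s' = v * absz t' + 1)%N].
Proof.
move=> s0 t0 s0' t0' Es' Et' E.
have E' : u%:Z * s' + v%:Z * t' = 1 by rewrite Es' Et' -E; ring.
have nat_abs (x : int) : 0 <= x -> exists n : nat, x = n%:Z.
  by move=> x0; exists (absz x); rewrite gez0_abs.
have [x Ex] : exists x : nat, - s = x%:Z by apply: nat_abs; lia.
have [y Ey] := nat_abs t (ltW t0); have [x' Ex'] := nat_abs s' (ltW s0').
have [y' Ey'] : exists y' : nat, - t' = y'%:Z by apply: nat_abs; lia.
have Es : s = - x%:Z by rewrite -Ex opprK.
have Et : t' = - y'%:Z by rewrite -Ey' opprK.
by subst s t s' t'; rewrite !abszN !absz_nat; split; try split; lia.
Qed.

Lemma euclid_abs (u d p : nat) (a qt : nat -> nat) (q := euclidean_q p qt)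
    (s := sigma u d q) (t := tau u d q) (s' := sigma u d q.+1) (t' := tau u d q.+1) :
    euclidean_data u d p a qt -> (0 < u)%N -> (2 * u < d)%N -> coprime u d ->
  [/\ (absz s + absz s' = d - u)%N /\ (absz t + absz t' = u)%N,
      (absz (s - t) = absz s + absz t)%N /\ (absz (s' - t') = absz s' + absz t')%N,
      ((d - u) * absz t = u * absz s + 1)%N \/ (u * absz s = (d - u) * absz t + 1)%N,
      ((d - u) * absz t' = u * absz s' + 1)%N \/ (u * absz s' = (d - u) * absz t' + 1)%N
    & (s' <= 0) = ~~ (s <= 0)].
Proof.
move=> euclid u0 ltud cop; have [v Ed] : exists v, d = (u + v)%N by exists (d - u)%N; lia.
have Ev : d%:Z - u%:Z = v%:Z by rewrite Ed PoszD addrAC subrr add0r.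
have -> : (d - u = v)%N by rewrite Ed addKn.
have := euclid_sigma_tau euclid u0 ltud cop; rewrite -/q -/s -/t -/s' -/t' !Ev.
case=> -[[h1 h2 h3 h4] [Es' Et' E]].
  have [H1 H2 -> ->] := abs_of_signs h1 h2 h3 h4 Es' Et' E.
  by split=> //; [left|right|rewrite h1 leNgt h3].
have {}E : u%:Z * s' + v%:Z * t' = 1 by rewrite -E Es' Et'; ring.
have [[H1 H1'] [H2 H2'] -> ->] := abs_of_signs h1 h2 h3 h4 Es' Et' E.
by split; [rewrite addnC H1 addnC H1'|split|right|left|rewrite h1 leNgt h3].
Qed.

(** * Adjoint pencils in terms of their coefficients *)

Unset Implicit Arguments.
Set Strict Implicit.
Set Printing Implicit Defensive.

Theorem theorem8p11 (K : closedFieldType) (charK : [pchar K] =i pred0)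
    (u d : nat) (lt1u : (1 < u)%N) (ltud : (2 * u < d)%N) (cop_ud : coprime u d)
    (p : nat) (ea eqt : nat -> nat) (euclid : euclidean_data u d p ea eqt)
    (l : nat) (led : (d - 2 <= l)%N) :
  let q := euclidean_q p eqt in
  let sq := sigma u d q in
  let tq := tau u d q in
  let sq1 := sigma u d q.+1 in
  let tq1 := tau u d q.+1 in
  forall (a b : 'X_{1..3} -> K) (P : {mpoly K[2 + 3]}),
    kerPhi0 u d 1 l P ->
    P = inS (form_of l (absz (sq - tq)) a) * F1 K u d q
        + inS (form_of l (absz (sq1 - tq1)) b) * F1 K u d q.+1 ->
    (Adj l (curve u d) P <->
     (forall m : 'X_{1..3}, (mdeg m + absz (sq - tq) = l)%N ->
        (u%:Z * (m 1)%:Z + d%:Z * (m 2)%:Z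
           < (d%:Z - 1) * (u%:Z - 1) - d%:Z * `|tq|) \/
        (d%:Z * (m 0)%:Z + (d%:Z - u%:Z) * (m 1)%:Z
           < (d%:Z - 1) * (d%:Z - u%:Z - 1) - (d%:Z - u%:Z) * `|sq - tq|) ->
        a m = 0) /\
     (forall m : 'X_{1..3}, (mdeg m + absz (sq1 - tq1) = l)%N ->
        (u%:Z * (m 1)%:Z + d%:Z * (m 2)%:Z
           < (d%:Z - 1) * (u%:Z - 1) - u%:Z * `|sq1 - tq1|) \/
        (d%:Z * (m 0)%:Z + (d%:Z - u%:Z) * (m 1)%:Z
           < (d%:Z - 1) * (d%:Z - u%:Z - 1) - d%:Z * `|sq1|) ->
        b m = 0)).
Proof.
move=> q sq tq sq1 tq1 a b P _ ->{P}.
have u0 : (0 < u)%N by lia.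
have [] := euclid_abs euclid u0 ltud cop_ud.
rewrite -/q -/sq -/tq -/sq1 -/tq1 => -[EN EM] [EL EL'] det det' sign.
have [v Ed] : exists v, d = (u + v)%N by exists (d - u)%N; lia.
have v0 : (0 < v)%N by lia.
have cop_uv : coprime u v by move: cop_ud; rewrite Ed /coprime gcdnDl.
rewrite Ed addKn in EN det det'.
have mdeg_mu n : absz (sigma u d n - tau u d n) = (absz (sigma u d n) + absz (tau u d n))%N ->
    mdeg (mu_mnm u d n) = absz (sigma u d n - tau u d n).
  by move=> ->; rewrite mdeg3E !mnm3E addn0.
have mdeg_nu n : mdeg (nu_mnm u d n) = absz (sigma u d n - tau u d n).
  by rewrite mdeg3E !mnm3E add0n addn0.
set A := form_of _ _ a; set B := form_of _ _ b.
set muq := mu_mnm u d q; set nuq := nu_mnm u d q.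
set muq1 := mu_mnm u d q.+1; set nuq1 := nu_mnm u d q.+1.
(* Since sigma_q and sigma_(q+1) lie on opposite sides of the sign test, X^mu of one index always
   meets X^nu of the other. Up to sign and exchange, [D0] and [D1] are the coefficients of T_0 and
   T_1. *)
pose D0 := A * 'X_[muq] + B * 'X_[nuq1]; pose D1 := A * 'X_[nuq] + B * 'X_[muq1].
have hD0 : D0 \is l.-homog.
  by apply: rpredD; apply: form_of_mulX_homog; [apply: mdeg_mu|apply: mdeg_nu].
have hD1 : D1 \is l.-homog.
  by apply: rpredD; apply: form_of_mulX_homog; [apply: mdeg_nu|apply: mdeg_mu].
have suppN (C : {mpoly K[3]}) : {in msupp (- C), forall m, adjoint_mnm u d m} <->
    {in msupp C, forall m, adjoint_mnm u d m}.
  by split=> H m; [rewrite -(perm_mem (msuppN C))|rewrite (perm_mem (msuppN C))]; apply: H.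
set P := (X in Adj _ _ X).
have AdjE : Adj l (curve u d) P <->
    {in msupp D0, forall m, adjoint_mnm u d m} /\ {in msupp D1, forall m, adjoint_mnm u d m}.
  have {sign}[[s0 s1]|[s0 s1]] : sq <= 0 /\ ~~ (sq1 <= 0) \/ ~~ (sq <= 0) /\ sq1 <= 0.
    by rewrite sign; case: (sq <= 0); [left|right].
  - have -> : P = varT K 0 * inS D0 + varT K 1 * inS (- D1).
      rewrite /P !F1E -/sq -/sq1 s0 (negPf s1) /inS rmorphN !rmorphD !rmorphM /=; ring.
    rewrite (pencil_adjointP charK lt1u ltud cop_ud hD0) ?rpredN //.
    by split=> -[h0 h1]; split=> //; apply/suppN.
  have -> : P = varT K 0 * inS D1 + varT K 1 * inS (- D0).
    rewrite /P !F1E -/sq -/sq1 s1 (negPf s0) /inS rmorphN !rmorphD !rmorphM /=; ring.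
  rewrite (pencil_adjointP charK lt1u ltud cop_ud hD1) ?rpredN //.
  by split=> -[h0 h1]; split=> //; apply/suppN.
have pair (m : 'X_{1..3}) := adjoint_mnm_mu_nu u0 v0 det cop_uv m.
have pair1 (m : 'X_{1..3}) := adjoint_mnm_mu_nu u0 v0 det' cop_uv m.
rewrite /= -EL -Ed in pair; rewrite /= -EL' -Ed in pair1.
rewrite AdjE /D0 /D1 !msupp_pair; first last.
- move=> m le1 le2; rewrite Ed; apply: (adjoint_mnm_overlap u0 v0 det EN EM le1).
  by rewrite -EL'.
- move=> m le1 le2; rewrite Ed; rewrite addnC in EN; rewrite addnC in EM.
  by apply: (adjoint_mnm_overlap u0 v0 det' EN EM le2); rewrite -EL.
have Ev : d%:Z - u%:Z = v%:Z by rewrite Ed PoszD addrAC subrr add0r.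
have d0 : (0 < d)%N by lia.
have dv : (d - u = v)%N by rewrite Ed addKn.
(* As x and y are positive, the truncated product agrees with the integer one; moving g across keeps
   the right side free of subtracting it. *)
have intW (x y g w : nat) : (0 < x)%N -> (0 < y)%N ->
    (w%:Z < (x%:Z - 1) * (y%:Z - 1) - g%:Z) = ~~ ((x - 1) * (y - 1) <= w + g)%N.
  by move=> x0 y0; have := mul_predn x0 y0; lia.
pose W m := adjoint_mnm u d m.
(* Condition (1) tests mu at (1:0:0) and nu at (0:0:1); condition (2), treated next, tests them the
   other way round. *)
have condA (m : 'X_{1..3}) :
    (u%:Z * (m 1)%:Z + d%:Z * (m 2)%:Z
       < (d%:Z - 1) * (u%:Z - 1) - d%:Z * `|tq|) \/
    (d%:Z * (m 0)%:Z + (d%:Z - u%:Z) * (m 1)%:Z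
       < (d%:Z - 1) * (d%:Z - u%:Z - 1) - (d%:Z - u%:Z) * `|sq - tq|) <->
    ~~ (W (muq + m)%MM && W (nuq + m)%MM).
  rewrite /W (pair m).1 negb_and (mulrC (d%:Z - 1) (_ - _ - _)) Ev.
  rewrite -!abszE -!PoszM -!PoszD !intW //.
  exact: rwP orP.
have condB (m : 'X_{1..3}) :
    (u%:Z * (m 1)%:Z + d%:Z * (m 2)%:Z
       < (d%:Z - 1) * (u%:Z - 1) - u%:Z * `|sq1 - tq1|) \/
    (d%:Z * (m 0)%:Z + (d%:Z - u%:Z) * (m 1)%:Z
       < (d%:Z - 1) * (d%:Z - u%:Z - 1) - d%:Z * `|sq1|) <->
    ~~ (W (muq1 + m)%MM && W (nuq1 + m)%MM).
  rewrite /W (pair1 m).2 negb_and (mulrC (d%:Z - 1) (_ - _ - _)) Ev.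
  rewrite -!abszE -!PoszM -!PoszD !intW //.
  exact: rwP orP.
have [FA GA] := msupp_form_of l (absz (sq - tq)) a
  (fun m => W (muq + m)%MM && W (nuq + m)%MM).
have [FB GB] := msupp_form_of l (absz (sq1 - tq1)) b
  (fun m => W (muq1 + m)%MM && W (nuq1 + m)%MM).
rewrite -/A in FA GA; rewrite -/B in FB GB.
(* The four support conditions come grouped by T_0 and T_1 and are regrouped by [A] and [B]. *)
split=> [[[A0 B1] [A1 B0]]|[H1 H2]].
  split=> m E; [move/condA; apply: FA E|move/condB; apply: FB E] => m' m'P.
    by rewrite /W A0 ?A1.
  by rewrite /W B0 ?B1.
have {}GA := GA (fun m E nW => H1 m E (proj2 (condA m) nW)).
have {}GB := GB (fun m E nW => H2 m E (proj2 (condB m) nW)).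
by split; split=> m mP; first [have /andP[] := GA m mP | have /andP[] := GB m mP].
Qed.
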